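(* Let $D\subseteq\mathbb{Z}^2$ be finite, let $\mathbf{B}$ be a non-negative integer $n\times n$ matrix, and let $t_0$ be an integer such that $f_D-t$ has no line polynomial factors for every complex $t\neq t_0$, and $\det(\mathbf{B}-t_0\mathbf{I})\neq0$. Then there are only finitely many $(D,\mathbf{B})$-colorings, and one can effectively construct them from $D$, $\mathbf{B}$, $t_0$. In particular, there is an algorithm to determine whether any $(D,\mathbf{B})$-colorings exist.
   Context: Write $X^{\vec u}=x^{u_1}y^{u_2}$ and $f_D=\sum_{\vec u\in D}X^{-\vec u}$. A line polynomial is a Laurent polynomial in $\mathbb{C}[x^{\pm1},y^{\pm1}]$ whose support has at least two points, all on one line; a line polynomial factor is a divisor that is a line polynomial. For the alphabet $\mathcal{A}=\{a_1,\dots,a_n\}$, a $(D,\mathbf{B})$-coloring is a configuration $c\in\mathcal{A}^{\mathbb{Z}^2}$ such that for all $i,j$ and every $\vec u$ with $c_{\vec u}=a_j$, the number of $\vec v\in\vec u+D$ with $c_{\vec v}=a_i$ equals $b_{ij}$. $\mathbf{I}$ is the identity matrix. Such colorings are two-dimensional configurations. When finitely many, each is invariant under two linearly independent translations and is given by a finite periodic description. *)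

(* Defs.v *)
From HB Require Import structures.
From mathcomp Require Import all_boot all_order all_algebra.
From mathcomp Require Import finmap monalg.
From mathcomp Require Import complex.
From mathcomp Require Import classical_sets cardinality reals.

Set Implicit Arguments.
Unset Strict Implicit.
Unset Printing Implicit Defensive.

Import Order.TTheory GRing.Theory Num.Theory.
Local Open Scope ring_scope.

Notation vec := (int * int)%type.

Section Laurent.
Variable R : realType.

(* Finitely supported families of coefficients, [<< a *g u >>] standing for the
   term a X^u.  The ring structure that monalg puts on [{malg K[G]}] requires
   the exponents to have no nontrivial invertible element, which excludes Z^2;
   hence the explicit product below. *)
Definition laurent := {malg (R[i])[vec]}.

Definition laurent_mul (g h : laurent) : laurent :=
  \sum_(u <- msupp g) \sum_(v <- msupp h) << g@_u * h@_v *g u + v >>.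

Definition laurent_dvd (g f : laurent) : Prop :=
  exists h : laurent, f = laurent_mul g h.

Definition line_polynomial (g : laurent) : Prop :=
  (1 < #|` msupp g|)%N /\
  exists a b c : R, (a, b) != (0, 0) /\
    forall u : vec, u \in msupp g -> a * u.1%:~R + b * u.2%:~R = c.

(* The zero polynomial is divisible by every line polynomial, so it does have
   line polynomial factors. *)
Definition has_line_factor (f : laurent) : Prop :=
  exists2 g : laurent, line_polynomial g & laurent_dvd g f.

Definition shape_poly (D : {fset vec}) : laurent :=
  \sum_(u <- D) << 1 *g - u >>.

Definition laurent_const (t : R[i]) : laurent := << t *g 0 >>.

End Laurent.

(* Configurations over the alphabet {a_1, ..., a_n}, a letter being identified
   with its index in 'I_n. *)
Definition config (n : nat) := vec -> 'I_n.

Definition coloring (n : nat) (D : {fset vec}) (B : 'M[nat]_n)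
    (c : config n) : Prop :=
  forall (i j : 'I_n) (u : vec), c u = j ->
    #|` [fset v in [fset (u + d)%R | d in D] | c v == i]%fset| = B i j.

Definition admissible (R : realType) (n : nat) (D : {fset vec})
    (B : 'M[nat]_n) (t0 : int) : Prop :=
  (forall t : R[i], t != t0%:~R ->
     ~ has_line_factor (shape_poly R D - laurent_const t)) /\
  \det (map_mx Posz B - t0%:M) != 0.

(* The description (k, w) stands for the configuration with periods (k, 0) and
   (0, k) whose values on the square [0, k)^2 are listed, row by row, in w. *)
Definition descr := (nat * seq nat)%type.

Definition describes (n : nat) (d : descr) (c : config n) : Prop :=
  let: (k, w) := d in
  [/\ (0 < k)%N, size w = (k * k)%N &
      forall x y : int,
        nth 0%N w (`|(x %% k)%Z| * k + `|(y %% k)%Z|)%N = c (x, y) :> nat].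

(* Unary partial recursive functions on nat: the least class containing zero,
   successor and the two projections of a pairing bijection, closed under
   pairing, composition, primitive recursion and unbounded minimization. *)

(* Cantor's bijection: the triangular number of a + b, plus b. *)
Definition cpair (a b : nat) : nat := ('C((a + b).+1, 2) + b)%N.

Inductive prf : Type :=
| Zero | Succ | Left | Right
| Pair of prf & prf
| Comp of prf & prf
| Prec of prf & prf
| Rfind of prf.

(* [eval f x y]: the computation of f on x halts with value y. *)
Inductive eval : prf -> nat -> nat -> Prop :=
| eval_zero x : eval Zero x 0
| eval_succ x : eval Succ x x.+1
| eval_left a b : eval Left (cpair a b) a
| eval_right a b : eval Right (cpair a b) b
| eval_pair f g x y z :
    eval f x y -> eval g x z -> eval (Pair f g) x (cpair y z)
| eval_comp f g x y z :
    eval g x y -> eval f y z -> eval (Comp f g) x z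
| eval_prec0 f g a y :
    eval f a y -> eval (Prec f g) (cpair a 0) y
| eval_precS f g a m y z :
    eval (Prec f g) (cpair a m) y -> eval g (cpair a (cpair m y)) z ->
    eval (Prec f g) (cpair a m.+1) z
| eval_rfind f a m (w : nat -> nat) :
    (forall k, (k < m)%N -> eval f (cpair a k) (w k).+1) ->
    eval f (cpair a m) 0 ->
    eval (Rfind f) a m.

Lemma cpair_inj a b a' b' : cpair a b = cpair a' b' -> a = a' /\ b = b'.
Proof.
have lt_sum p q p' q' : (p + q < p' + q')%N -> (cpair p q < cpair p' q')%N.
  move=> lt_s; apply: (@leq_trans 'C((p + q).+2, 2)).
    by rewrite [X in (_ < X)%N]binS bin1 /cpair ltn_add2l ltnS leq_addl.
  by rewrite (leq_trans _ (leq_addr _ _)) // leq_bin2l.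
move=> eq_ab; have eq_s : (a + b = a' + b')%N.
  by case: (ltngtP (a + b) (a' + b')) => // /lt_sum; rewrite eq_ab ltnn.
have eq_b : b = b' by move: eq_ab; rewrite /cpair eq_s => /addnI.
by split=> //; move: eq_s; rewrite eq_b => /addIn.
Qed.

Lemma eval_inv f x z : eval f x z ->
  match f with
  | Zero => z = 0%N
  | Succ => z = x.+1
  | Left => exists b, x = cpair z b
  | Right => exists a, x = cpair a z
  | Pair g h => exists a b, [/\ eval g x a, eval h x b & z = cpair a b]
  | Comp g h => exists2 a, eval h x a & eval g a z
  | Prec g h => (exists2 a, x = cpair a 0 & eval g a z) \/
      exists a m b, [/\ x = cpair a m.+1, eval (Prec g h) (cpair a m) b
                       & eval h (cpair a (cpair m b)) z]
  | Rfind g => (exists w : nat -> nat,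
      forall k, (k < z)%N -> eval g (cpair x k) (w k).+1) /\
      eval g (cpair x z) 0
  end.
Proof.
case=> {f x z} //.
- by move=> a b; exists b.
- by move=> a b; exists a.
- by move=> f g x y z; exists y, z.
- by move=> f g x y z; exists y.
- by move=> f g a y; left; exists a.
- by move=> f g a m y z; right; exists a, m, y.
- by move=> f a m w Hw H0; split=> //; exists w.
Qed.

Lemma eval_fun f x y z : eval f x y -> eval f x z -> y = z.
Proof.
move=> E; elim: E z => {f x y}.
- by move=> x z /eval_inv.
- by move=> x z /eval_inv.
- by move=> a b z /eval_inv[b' /cpair_inj[]].
- by move=> a b z /eval_inv[a' /cpair_inj[]].
- by move=> f g x y z _ IHf _ IHg _ /eval_inv[a [b [/IHf-> /IHg-> ->]]].
- by move=> f g x y z _ IHg _ IHf z' /eval_inv[a /IHg<- /IHf].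
- move=> f g a y _ IHf z /eval_inv[[a' /cpair_inj[<- _] /IHf //]|].
  by case=> a' [m [b [/cpair_inj[]]]].
- move=> f g a m y z _ IHm _ IHg z' /eval_inv[[a' /cpair_inj[] //]|].
  by case=> a' [m' [b [/cpair_inj[<- [<-]] /IHm<- /IHg]]].
- move=> f a m w _ IHw _ IH0 z /eval_inv[[w' Hw'] H0].
  case: (ltngtP m z) => // lt_m; first by have := IH0 _ (Hw' _ lt_m).
  by have := IHw _ lt_m _ H0.
Qed.

Definition code_int (z : int) : nat :=
  match z with Posz m => m.*2 | Negz m => m.*2.+1 end.

Definition code_vec (u : vec) : nat := cpair (code_int u.1) (code_int u.2).

Definition code_seq (T : Type) (code : T -> nat) (s : seq T) : nat :=
  foldr (fun x a => (cpair (code x) a).+1) 0%N s.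

Definition code_mx (n : nat) (B : 'M[nat]_n) : nat :=
  code_seq (code_seq id) [seq [seq B i j | j <- enum 'I_n] | i <- enum 'I_n].

(* x is an input representing D, B and t0; the set D may be presented by any
   duplicate-free enumeration of its elements. *)
Definition represents (n : nat) (D : {fset vec}) (B : 'M[nat]_n) (t0 : int)
    (x : nat) : Prop :=
  exists2 s : seq vec, perm_eq s D &
    x = cpair (code_seq code_vec s) (cpair (code_mx B) (code_int t0)).

Definition code_descr (d : descr) : nat := cpair d.1 (code_seq id d.2).

Definition lists_colorings (n : nat) (D : {fset vec}) (B : 'M[nat]_n)
    (l : seq descr) : Prop :=
  (forall d, d \in l -> exists2 c : config n, coloring D B c & describes d c) /\
  (forall c : config n, coloring D B c -> exists2 d, d \in l & describes d c).

(* Main.v *)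
(** The letters' indicator differences of two colorings form a vector d with f_D d = B d, so by
    Cayley-Hamilton a product of factors f_D - t with t <> t0 annihilates d.  If no ball determined
    a coloring, pairs recentred at the boundary of larger and larger balls of agreement would have a
    limit pair differing at the origin but agreeing on a half-plane.  When the boundary of the
    half-plane contains no lattice direction, an extreme monomial of f_D - t shows that applying
    f_D - t preserves being nonzero.  Otherwise d is a one-sided stack of rows in the boundary
    direction k; each row satisfies, modulo the previous ones, a linear recurrence, and since d takes
    finitely many values all rows have a common period.  Passing to an eigenvector of the shift by k,
    of eigenvalue w, restricts f_D - t to a Laurent polynomial in one variable, which is nonzero
    because the line polynomial w X^k - 1 does not divide f_D - t; a one-sided sequence is not
    annihilated by such a polynomial.  Hence colorings are determined by a ball, which bounds their
    number and gives them a common period.  By compactness that period is visible on every locally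
    legal pattern of some finite size, and this finite check is what the program searches for. *)

Require Import Defs.
From mathcomp Require Import all_boot all_order all_algebra.
From mathcomp Require Import finmap monalg complex.
From mathcomp Require Import ring zify.
From mathcomp Require Import boolp classical_sets filter cardinality reals.

Set Implicit Arguments.
Unset Strict Implicit.
Unset Printing Implicit Defensive.

Import Order.TTheory GRing.Theory Num.Theory.

Local Open Scope ring_scope.

(** * Doubly indexed arrays annihilated by a family of polynomials *)

(** The variable acts as the forward shift, so [poly_act p s i = 0] for all [i] is the two-sided
    linear recurrence with characteristic polynomial [p]. *)
Definition poly_act (C : nzRingType) (p : {poly C}) (s : int -> C) (i : int) : C :=
  \sum_(a < size p) p`_a * s (i + a%:Z).

Section PolyAct.
Variable C : fieldType.
Implicit Types (p : {poly C}) (s t : int -> C).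

Lemma poly_act_wide N p s i : (size p <= N)%N ->
  poly_act p s i = \sum_(a < N) p`_a * s (i + a%:Z).
Proof.
move=> leN; rewrite /poly_act (big_ord_widen N (fun a => p`_a * s (i + a%:Z))) //.
rewrite big_mkcond /=; apply: eq_bigr => a _; case: ltnP => // lea.
by rewrite nth_default ?mul0r.
Qed.

Lemma poly_actMXsubC p w s :
  poly_act (p * ('X - w%:P)) s = poly_act p (fun i => s (i + 1) - w * s i).
Proof.
apply: funext => i.
have leX : (size (p * ('X - w%:P))%R <= (size p).+1)%N.
  by rewrite (leq_trans (size_polyMleq _ _)) // size_XsubC addn2.
have -> : poly_act (p * ('X - w%:P)) s i = \sum_(a < (size p).+1) (p * 'X)`_a * s (i + a%:Z)
   - \sum_(a < (size p).+1) w * (p`_a * s (i + a%:Z)).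
  rewrite (poly_act_wide s i leX) -sumrB; apply: eq_bigr => a _.
  by rewrite mulrBr coefB coefMC mulrBl [p`_a * w]mulrC mulrA.
rewrite big_ord_recl coefMX /= mul0r add0r big_ord_recr /=.
rewrite [p`_(size p)]nth_default // mul0r mulr0 addr0 -sumrB.
apply: eq_bigr => a _; rewrite coefMX /= mulrBr mulrCA; congr (_ * s _ - _).
by rewrite PoszD addrA addrAC.
Qed.

Lemma poly_act_sub p s t i :
  poly_act p (fun j => s j - t j) i = poly_act p s i - poly_act p t i.
Proof. by rewrite -sumrB; apply: eq_bigr => a _; rewrite mulrBr. Qed.

Lemma poly_act_scale p w s i :
  poly_act p (fun j => w * s j) i = w * poly_act p s i.
Proof. by rewrite mulr_sumr; apply: eq_bigr => a _; rewrite mulrCA. Qed.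

Lemma poly_act_shift p s m i :
  poly_act p (fun j => s (j + m)) i = poly_act p s (i + m).
Proof. by apply: eq_bigr => a _; rewrite addrAC. Qed.

Lemma poly_act_geom p w s i : (forall j, s (j + 1) = w * s j) ->
  poly_act p s i = p.[w] * s i.
Proof.
move=> sw; have sE a : s (i + a%:Z) = w ^+ a * s i.
  elim: a => [|a IH]; first by rewrite addr0 mul1r.
  by rewrite exprS -mulrA -IH -sw; congr s; lia.
by rewrite horner_coef mulr_suml; apply: eq_bigr => a _; rewrite sE mulrA.
Qed.

(* Both extreme coefficients of [p] are nonzero, so a window determines the sequence in both
   directions. *)
Lemma poly_act_window p s (i0 : int) : p != 0 -> (forall i, poly_act p s i = 0) ->
  (forall a, (a < (size p).-1)%N -> s (i0 + a%:Z) = 0) -> forall i, s i = 0.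
Proof.
move=> p0 ps0 win.
have sp : (0 < size p)%N by rewrite size_poly_gt0.
have exl : exists l, p`_l != 0 by exists (size p).-1; rewrite -lead_coefE lead_coef_eq0.
case: (ex_minnP exl) => l pl lmin.
have lt_l : (l < size p)%N by rewrite ltnNge; apply: contra pl => le; rewrite nth_default.
have fwd k : s (i0 + k%:Z) = 0.
  elim/ltn_ind: k => k IH; have [/win //|le] := ltnP k (size p).-1.
  have := ps0 (i0 + k%:Z - (size p).-1%:Z).
  rewrite /poly_act; case E: (size p) sp => [//|r] _ in le *.
  rewrite big_ord_recr /= big1 ?add0r; last first.
    move=> a _; rewrite (_ : i0 + _ - _ + _ = i0 + (k - r + a)%N%:Z) ?IH ?mulr0 //.
      by move: (ltn_ord a) => /= ?; lia.
    by move: le => /=; lia.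
  move/eqP; rewrite mulf_eq0 subrK => /orP[|/eqP //].
  by rewrite -[r]/(r.+1.-1) -E -lead_coefE lead_coef_eq0 (negPf p0).
(* Backwards, the recurrence is solved for the term at the lowest nonzero coefficient, of index [l];
   the later terms lie further right and vanish by induction. *)
have bwd k : s (i0 + (size p).-1%:Z - k%:Z) = 0.
  elim/ltn_ind: k => k IH.
  have [le|lt] := leqP k (size p).-1.
    rewrite (_ : _ - _ = i0 + ((size p).-1 - k)%N%:Z) ?fwd //; lia.
  have := ps0 (i0 + (size p).-1%:Z - k%:Z - l%:Z).
  rewrite /poly_act (bigD1 (Ordinal lt_l)) //= subrK big1 ?addr0.
    by move/eqP; rewrite mulf_eq0 (negPf pl) => /eqP.
  move=> a; rewrite -val_eqE /= => ne.
  have [lt_al|le_la] := ltnP a l.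
    by rewrite (_ : p`_a = 0) ?mul0r //; apply/eqP/negP => /negP /lmin; rewrite leqNgt lt_al.
  rewrite (_ : _ + _ = i0 + (size p).-1%:Z - (k - (a - l))%N%:Z); last first.
    have lea : (a <= (size p).-1)%N by rewrite -ltnS prednK.
    by move: (size p).-1 (nat_of_ord a) lt le_la lea => r b; lia.
  by rewrite IH ?mulr0 //; lia.
move=> i; have [le|lt] := lerP i0 i.
  by have := fwd (absz (i - i0)%R); rewrite (_ : _ + _ = i) //; lia.
have := bwd (absz (i0 + (size p).-1%:Z - i)%R).
by rewrite (_ : _ - _ = i) //; lia.
Qed.

Lemma periodic_mul s (p m : nat) : (forall i, s (i + p%:Z) = s i) -> (p %| m)%N ->
  forall i, s (i + m%:Z) = s i.
Proof.
move=> per /dvdnP[q ->] i; elim: q => [|q IH]; first by rewrite mul0n addr0.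
by rewrite mulSn PoszD addrA addrAC per.
Qed.

(** A window of length [(size p).-1] determines a solution and takes at most [#|T|] values. Two of
    [#|T|.+1] consecutive windows coincide, which gives a period at most [#|T|]; the factorial of
    [#|T|] is thus a period common to all solutions with values in [V]. *)
Lemma poly_act_periodic p (V : seq C) : p != 0 ->
  exists2 m, (0 < m)%N & forall s, (forall i, s i \in V) ->
    (forall i, poly_act p s i = 0) -> forall i, s (i + m%:Z) = s i.
Proof.
move=> p0; pose T := {ffun 'I_(size p).-1 -> seq_sub V}; exists (#|T|)`!; first exact: fact_gt0.
move=> s sV ps0.
pose f (k : 'I_#|T|.+1) : T := [ffun a => SeqSub (sV (k%:Z + (val a)%:Z))].
have /injectivePn[k [k' ne eq_f]] : ~~ injectiveb f.
  by apply/negP => /injectiveP/leq_card; rewrite card_ord ltnn.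
wlog lt : k k' ne eq_f / (k < k')%N => [H|].
  have [lt|gt|/val_inj e] := ltngtP k k'; [exact: (H k k')| |by rewrite e eqxx in ne].
  by apply: (H k' k) => //; rewrite eq_sym.
apply: (@periodic_mul s (k' - k)); last first.
  by rewrite dvdn_fact // subn_gt0 lt /= (leq_trans (leq_subr _ _)) // -ltnS.
move=> i; apply/eqP; rewrite -subr_eq0; apply/eqP.
apply: (@poly_act_window p (fun i => s (i + (k' - k)%:Z) - s i) k%:Z) => //.
  by move=> j; rewrite poly_act_sub poly_act_shift !ps0 subr0.
move=> a lta; have := congr1 (fun g : T => val (g (Ordinal lta))) eq_f.
rewrite !ffunE /= addrAC (_ : k%:Z + (k' - k)%N%:Z = k'%:Z) => [->|]; first by rewrite subrr.
by rewrite -PoszD subnKC // ltnW.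
Qed.

End PolyAct.

(** * Arrays that vanish on all high rows *)

Section Core.
Variables (C : numClosedFieldType) (L : nat) (phi : nat -> {poly C}).
Implicit Types (d : int -> int -> C) (w : C).

(** With [Y] the step to the next row, the bivariate polynomial with coefficient [phi b] at [Y^b]
    annihilates [d]. *)
Let rows_eq d := forall j i, \sum_(b < L) poly_act (phi b) (d (j + (b : nat)%:Z)) i = 0.

Lemma rows_ind (P : int -> Prop) (J0 : int) : (forall j : int, J0 < j -> P j) ->
  (forall j : int, (forall k : nat, (0 < k)%N -> P (j + k%:Z)) -> P j) -> forall j, P j.
Proof.
move=> Phigh Pstep j; have [|le] := ltP J0 j; first exact: Phigh.
have [n jE] : exists n : nat, j = J0 - n%:Z.
  by exists (absz (J0 - j)%R); lia.
elim/ltn_ind: n j jE {le} => n IH j ->; apply: Pstep => k k0.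
have [le|lt] := leqP k n; last by apply: Phigh; lia.
by apply: (IH (n - k)%N); lia.
Qed.

(** On eigenvectors of the horizontal shift, [phi b] acts as the scalar [(phi b).[w]]. For the least
    [b] where this is nonzero, the equation at row [j - b] isolates row [j]: the terms of lower rows
    have coefficient zero, and the rows above are already zero. *)
Lemma eigen_rows_eq0 d (J0 : int) w : (exists2 b, (b < L)%N & (phi b).[w] != 0) ->
  (forall j i, J0 < j -> d j i = 0) -> rows_eq d ->
  (forall j i, d j (i + 1) = w * d j i) -> forall j i, d j i = 0.
Proof.
move=> [b0 ltb0 phib0] dhigh deq dw.
have exb : exists b, (b < L)%N && ((phi b).[w] != 0) by exists b0; rewrite ltb0.
case: (ex_minnP exb) => b /andP[ltb phib] bmin.
apply: (@rows_ind (fun j => forall i, d j i = 0) J0) => [j lt i|j IH i]; first exact: dhigh.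
have := deq (j - b%:Z) i.
rewrite (bigD1 (Ordinal ltb)) //= big1 => [|c].
  by rewrite addr0 subrK (poly_act_geom _ _ (dw _)) => /eqP; rewrite mulf_eq0 (negPf phib) => /eqP.
rewrite (poly_act_geom _ _ (dw _)) -val_eqE /= => ne.
have [ltc|gtc|e] := ltngtP c b; last by rewrite e eqxx in ne.
  have [->|nz] := eqVneq (phi c).[w] 0; first by rewrite mul0r.
  by have := bmin c; rewrite ltn_ord nz leqNgt ltc => /(_ isT).
rewrite (_ : _ + _ = j + (c - b)%N%:Z) ?IH ?mulr0 ?subn_gt0 //.
by rewrite -subzn ?(ltnW gtc) // addrA addrAC.
Qed.

Hypothesis phi_nondeg : forall w, w != 0 -> exists2 b, (b < L)%N & (phi b).[w] != 0.

(** Subtracting [w] times a row from its shift preserves the row equations and uses up one root. By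
    induction the result is zero, so [d] is an eigenvector of the shift with nonzero eigenvalue
    [w]. *)
Lemma prod_rows_eq0 (rs : seq C) d (J0 : int) : 0 \notin rs ->
  (forall j i, J0 < j -> d j i = 0) -> rows_eq d ->
  (forall j i, poly_act (\prod_(w <- rs) ('X - w%:P)) (d j) i = 0) -> forall j i, d j i = 0.
Proof.
elim: rs d => [|w rs IH] d; rewrite ?inE ?negb_or => rs0 dhigh deq dprod j i.
  have := dprod j i; rewrite big_nil /poly_act size_poly1 big_ord1.
  by rewrite coef1 addr0 mul1r.
case/andP: rs0 => w0 rs0.
apply: (@eigen_rows_eq0 d J0 w) => //.
  by apply: phi_nondeg; rewrite eq_sym.
move=> {}j {}i; apply/eqP; rewrite -subr_eq0; apply/eqP; move: j i.
apply: (IH (fun j i => d j (i + 1) - w * d j i)) => //.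
- by move=> j i lt; rewrite !dhigh // mulr0 subr0.
- move=> j i; under eq_bigr do rewrite poly_act_sub poly_act_scale poly_act_shift.
  by rewrite sumrB -mulr_sumr !deq mulr0 subr0.
- move=> j i; rewrite -[RHS](dprod j i) big_cons -poly_actMXsubC.
  by congr (poly_act _ _ _); exact: mulrC.
Qed.

(** Along steps of [m] the sequence is an arithmetic progression with finitely many values; two
    equal terms force the common difference to vanish in characteristic zero. *)
Lemma arith_finite_const (V : seq C) (s : int -> C) (m : nat) : (forall i, s i \in V) ->
  (forall i, s (i + m%:Z + m%:Z) - s (i + m%:Z) = s (i + m%:Z) - s i) ->
  forall i, s (i + m%:Z) = s i.
Proof.
move=> sV prog i; pose t := s (i + m%:Z) - s i.
have tE (n : nat) : s (i + (n * m)%N%:Z + m%:Z) - s (i + (n * m)%N%:Z) = t.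
  elim: n => [|n IH]; first by rewrite mul0n addr0.
  by rewrite mulSn PoszD [m%:Z + _]addrC addrA prog.
have sE (n : nat) : s (i + (n * m)%N%:Z) = s i + n%:R * t.
  elim: n => [|n IH]; first by rewrite mul0n addr0 mul0r addr0.
  rewrite mulSn PoszD [m%:Z + _]addrC addrA -[LHS](subrK (s (i + (n * m)%N%:Z))) tE IH.
  by rewrite -natr1; ring.
pose f (n : 'I_#|{: seq_sub V}|.+1) : seq_sub V := SeqSub (sV (i + (n * m)%N%:Z)).
have /injectivePn[k [k' ne /(congr1 val)]] : ~~ injectiveb f.
  by apply/negP => /injectiveP/leq_card; rewrite card_ord ltnn.
rewrite /= !sE => /addrI/eqP; rewrite -subr_eq0 -mulrBl mulf_eq0 subr_eq0 eqr_nat.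
by rewrite (inj_eq val_inj) (negPf ne) /= subr_eq0 => /eqP.
Qed.

(** The first nonzero [phi b] yields a period [m] common to all rows, established from the top
    downwards. Then ['X^m - 1], which splits and does not have 0 as a root, annihilates each row,
    and [prod_rows_eq0] applies. *)
Lemma rows_eq0 (V : seq C) d (J0 : int) : (forall j i, d j i \in V) ->
  (forall j i, J0 < j -> d j i = 0) -> rows_eq d -> forall j i, d j i = 0.
Proof.
move=> dV dhigh deq.
have exb : exists b, (b < L)%N && (phi b != 0).
  have [b ltb phib] := phi_nondeg (oner_neq0 C); exists b; rewrite ltb.
  by apply: contraNneq phib => ->; rewrite horner0.
case: (ex_minnP exb) => b /andP[ltb phib] bmin.
(* The period is applied to the sequences [d j (i + m) - d j i], whose values are differences of
   elements of [V]. *)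
have [m m0 per] := poly_act_periodic [seq x - y | x <- V, y <- V] phib.
have dper : forall j i, d j (i + m%:Z) = d j i.
  apply: (@rows_ind _ J0) => [j lt i|j IH]; first by rewrite !dhigh.
  (* [d j (i + m) - d j i] is killed by [phi b], hence [m]-periodic: each row grows
     arithmetically, and takes finitely many values. *)
  apply: arith_finite_const (dV j) _ => i.
  apply: (per (fun i => d j (i + m%:Z) - d j i)) => [k|k].
    exact: (allpairs_f (fun x y => x - y)).
  have := congr2 (fun x y => x - y) (deq (j - b%:Z) (k + m%:Z)) (deq (j - b%:Z) k).
  rewrite subr0 -sumrB (bigD1 (Ordinal ltb)) //= subrK big1.
    by rewrite addr0 poly_act_sub poly_act_shift.
  move=> c; rewrite -val_eqE /= => ne.
  have [ltc|gtc|e] := ltngtP c b; last by rewrite e eqxx in ne.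
    have [->|nz] := eqVneq (phi c) 0; first by rewrite /poly_act size_poly0 !big_ord0 subr0.
    by have := bmin c; rewrite ltn_ord nz leqNgt ltc => /(_ isT).
  rewrite (_ : _ + (c : nat)%:Z = j + (c - b)%N%:Z); last first.
    by rewrite -subzn ?(ltnW gtc) // addrA addrAC.
  rewrite -poly_act_shift (funext (IH _ _)) ?subrr // subn_gt0 //.
have mN0 : ('X^m - 1 : {poly C}) \is monic by rewrite monicXnsubC.
have [rs rsE] := closed_field_poly_normal ('X^m - 1 : {poly C}).
rewrite (monicP mN0) scale1r in rsE.
apply: (@prod_rows_eq0 rs d J0) => //.
  rewrite -root_prod_XsubC -rsE /root !hornerE expr0n gtn_eqF //.
  by rewrite sub0r oppr_eq0 oner_eq0.
case: m m0 {per} dper {mN0} rsE => [//|m] _ dper rsE j i.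
rewrite -rsE (poly_act_wide (N := m.+2)) ?size_Xn_sub_1 //.
rewrite big_ord_recr big_ord_recl /= big1 => [|a _].
  by rewrite !coefB !coefXn !coef1 eqxx /= !addr0 dper; ring.
by rewrite coefB coefXn coef1 /bump add1n eqSS (ltn_eqF (ltn_ord a)) subrr mul0r.
Qed.

End Core.

(** * Line factors of Laurent polynomials *)

Lemma exprnN_cancel (F : fieldType) (z c : F) (n : nat) : z != 0 ->
  z ^+ n.+1 * - (z ^ (- n.+1%:Z) * c) = - c.
Proof. by move=> z0; rewrite mulrN mulrA -exprnN mulfV ?mul1r // expf_neq0. Qed.

Section LaurentFactor.
Variable R : realType.
Local Notation C := (R[i]).
Implicit Types (f g h : laurent R) (a c z : C) (u v : vec).

Lemma laurent_mul_wide (E F : {fset vec}) g h : (msupp g `<=` E)%fset -> (msupp h `<=` F)%fset ->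
  laurent_mul g h = \sum_(u <- E) \sum_(v <- F) << g@_u * h@_v *g u + v >>.
Proof.
move=> gE hF; rewrite /laurent_mul (big_fset_incl _ gE) /=; last first.
  move=> u _ ug; apply: big1 => v _.
  by rewrite (mcoeff_outdom ug) mul0r monalgU0.
apply: eq_bigr => u _; apply: (big_fset_incl _ hF) => v _ vh.
by rewrite (mcoeff_outdom vh) mulr0 monalgU0.
Qed.

Lemma laurent_mulDr g h1 h2 : laurent_mul g (h1 + h2) = laurent_mul g h1 + laurent_mul g h2.
Proof.
have s1 := fsubsetUl (msupp h1) (msupp h2); have s2 := fsubsetUr (msupp h1) (msupp h2).
have sg := fsubset_refl (msupp g).
rewrite (laurent_mul_wide sg (msuppD_le h1 h2)) (laurent_mul_wide sg s1) (laurent_mul_wide sg s2).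
rewrite -big_split; apply: eq_bigr => u _; rewrite -big_split; apply: eq_bigr => v _ /=.
by rewrite mcoeffD mulrDr monalgUD.
Qed.

Lemma laurent_mulBl g1 g2 h : laurent_mul (g1 - g2) h = laurent_mul g1 h - laurent_mul g2 h.
Proof.
have s1 := fsubsetUl (msupp g1) (msupp g2); have s2 := fsubsetUr (msupp g1) (msupp g2).
have sh := fsubset_refl (msupp h).
rewrite (laurent_mul_wide (msuppB_le g1 g2) sh) (laurent_mul_wide s1 sh) (laurent_mul_wide s2 sh).
rewrite -sumrB; apply: eq_bigr => u _; rewrite -sumrB; apply: eq_bigr => v _ /=.
by rewrite mcoeffB mulrBl monalgUB.
Qed.

Lemma laurent_mulUU a u c v : laurent_mul << a *g u >> << c *g v >> = << a * c *g u + v >>.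
Proof. by rewrite (laurent_mul_wide msuppU_le msuppU_le) !big_seq_fset1 !mcoeffUU. Qed.

Lemma laurent_dvd0 g : laurent_dvd g 0.
Proof. by exists 0; rewrite /laurent_mul msupp0; apply/esym/big1 => u _; rewrite big_nil. Qed.

Lemma laurent_dvdD g h1 h2 : laurent_dvd g h1 -> laurent_dvd g h2 -> laurent_dvd g (h1 + h2).
Proof. by move=> [q1 ->] [q2 ->]; exists (q1 + q2); rewrite laurent_mulDr. Qed.

Definition line_binomial (k : vec) z : laurent R := << 1 *g k >> - << z *g 0 >>.

Lemma line_binomial_line (k : vec) z : k != 0 -> z != 0 -> line_polynomial (line_binomial k z).
Proof.
move=> k0 z0; split.
  have sub : ([fset k; 0] `<=` msupp (line_binomial k z))%fset.
    apply/fsubsetP => u; rewrite in_fset2 -mcoeff_neq0 mcoeffB !mcoeffU.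
    case/orP => /eqP->; first by rewrite eqxx [0 == k]eq_sym (negPf k0) subr0 oner_eq0.
    by rewrite eqxx (negPf k0) sub0r oppr_eq0.
  by apply: leq_trans (fsubset_leq_card sub); rewrite cardfs2 k0.
exists (- k.2%:~R), k.1%:~R, 0; split.
  move: k0; rewrite -pair_eqE /= negb_and -[in X in _ -> X]pair_eqE /= negb_and.
  by rewrite oppr_eq0 !intr_eq0 orbC.
move=> u; rewrite -mcoeff_neq0 mcoeffB !mcoeffU.
have [<- _|_] := eqVneq k u; first by rewrite mulNr mulrC addrC subrr.
have [<- _|_] := eqVneq (0 : vec) u; first by rewrite /= !mulr0 addr0.
by rewrite subrr eqxx.
Qed.

Lemma dvd_binomial_step k z c v :
  laurent_dvd (line_binomial k z) (<< c *g k + v >> - << z * c *g v >>).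
Proof. by exists << c *g v >>; rewrite laurent_mulBl !laurent_mulUU mul1r add0r. Qed.

Lemma dvd_binomial_nat k z c v (n : nat) :
  laurent_dvd (line_binomial k z) (<< c *g k *+ n + v >> - << z ^+ n * c *g v >>).
Proof.
elim: n c => [|n IH] c; first by rewrite mulr0n mul1r add0r subrr; apply: laurent_dvd0.
rewrite -[X in laurent_dvd _ X](subrKA << z * c *g k *+ n + v >>).
apply: laurent_dvdD; first by rewrite mulrS -addrA; apply: dvd_binomial_step.
by rewrite exprSr -mulrA.
Qed.

(** Modulo the binomial, translating an exponent by [k] amounts to multiplying by [z]. For negative
    [i] the natural case is run from the translated exponent up to [v]. *)
Lemma dvd_binomial k z c v (i : int) : z != 0 ->
  laurent_dvd (line_binomial k z) (<< c *g k *~ i + v >> - << z ^ i * c *g v >>).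
Proof.
move=> z0; case: i => n; first exact: dvd_binomial_nat.
have := exprnN_cancel c n z0; rewrite NegzE; move: (z ^ _ * c) => a aE.
have := dvd_binomial_nat k z (- a) (k *~ (- n.+1%:Z) + v) n.+1.
rewrite aE addrA pmulrn -mulrzDr subrr mulr0z add0r.
by rewrite !monalgUN opprK addrC.
Qed.

End LaurentFactor.

Section PolyActSum.
Variable C : fieldType.

Lemma poly_actD (p q : {poly C}) s i : poly_act (p + q) s i = poly_act p s i + poly_act q s i.
Proof.
rewrite (poly_act_wide s i (size_polyD p q)) (poly_act_wide s i (leq_maxl (size p) (size q))).
rewrite (poly_act_wide s i (leq_maxr (size p) (size q))) -big_split.
by apply: eq_bigr => a _; rewrite coefD mulrDl.
Qed.

Lemma poly_act_monom (a : C) n s i : poly_act (a *: 'X^n) s i = a * s (i + n%:Z).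
Proof.
rewrite (poly_act_wide (N := n.+1)); last first.
  by apply: leq_trans (size_scale_leq _ _) _; rewrite size_polyXn.
rewrite big_ord_recr /= big1 => [|b _]; first by rewrite add0r coefZ coefXn eqxx mulr1.
by rewrite coefZ coefXn (ltn_eqF (ltn_ord b)) mulr0 mul0r.
Qed.

Lemma poly_act_sum (I : Type) (r : seq I) (P : pred I) (a : I -> C) (n : I -> nat) s i :
  poly_act (\sum_(x <- r | P x) a x *: 'X^(n x)) s i = \sum_(x <- r | P x) a x * s (i + (n x)%:Z).
Proof.
rewrite (@big_morph _ _ (fun p : {poly C} => poly_act p s i) 0 +%R) => [|p q|].
- by apply: eq_bigr => x _; rewrite poly_act_monom.
- exact: poly_actD.
- by rewrite /poly_act size_poly0 big_ord0.
Qed.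

End PolyActSum.

Lemma exprz_rescale (C : fieldType) (w c : C) (i m : int) : w != 0 ->
  w ^ i * c = w ^ (- m) * (c * w ^ (i + m)).
Proof.
move=> w0; rewrite (mulrCA (w ^ (- m)) c) -(expfzDr (- m) (i + m) w0).
have -> : - m + (i + m) = i by ring.
exact: mulrC.
Qed.

Lemma malgU_sum (C : nzRingType) (I : Type) (r : seq I) (P : pred I) (F : I -> C) (v : vec) :
  \sum_(x <- r | P x) << F x *g v >> = << \sum_(x <- r | P x) F x *g v >> :> {malg C[vec]}.
Proof.
apply/esym/(@big_morph _ _ (fun x : C => << x *g v >>) 0 +%R); last exact: monalgU0.
exact: monalgUD.
Qed.

(** The action of [f_D - t] on functions: a monomial [X^v] translates by [v], so the exponents [- u]
    of [f_D] read the values at [w + u]. *)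
Definition shape_op (C : nzRingType) (D : {fset vec}) (t : C) (d : vec -> C) (w : vec) : C :=
  \sum_(u <- D) d (w + u) - t * d w.

(** * One factor [f_D - t] in coordinates adapted to a lattice direction *)

Section SingleFactor.
Variable R : realType.
Local Notation C := (R[i]).
Variables (D : {fset vec}) (t : C) (k1 k2 p q : int).
Hypothesis bezout : p * k1 + q * k2 = 1.
Hypothesis no_line : ~ has_line_factor (shape_poly R D - laurent_const t).

(** Coordinates in the basis [(k1, k2)], [(- q, p)] of the lattice, unimodular by the Bezout
    relation. The rows are the cosets of the multiples of [(k1, k2)]. *)
Definition axis_coord (u : vec) : int := p * u.1 + q * u.2.
Definition row_coord (u : vec) : int := k1 * u.2 - k2 * u.1.
Definition lattice_point (i j : int) : vec := (i * k1 - j * q, i * k2 + j * p).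

Lemma lattice_pointK u : lattice_point (axis_coord u) (row_coord u) = u.
Proof.
case: u => x y; rewrite /lattice_point /axis_coord /row_coord /=; congr pair.
  by rewrite -[RHS]mul1r -bezout; ring.
by rewrite -[RHS]mul1r -bezout; ring.
Qed.

Lemma lattice_pointD i j i' j' :
  lattice_point (i + i') (j + j') = lattice_point i j + lattice_point i' j'.
Proof. by rewrite /lattice_point; congr pair => /=; ring. Qed.

Lemma row_coordK i j : row_coord (lattice_point i j) = j.
Proof. by rewrite /row_coord /lattice_point /= -[RHS]mulr1 -bezout; ring. Qed.

Lemma lattice_pointE i j : lattice_point i j = (k1, k2) *~ i + lattice_point 0 j.
Proof.
have -> : (k1, k2) *~ i = lattice_point i 0.
  rewrite [LHS]surjective_pairing !raddfMz /lattice_point /=.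
  by congr pair; rewrite mulrzz; ring.
by rewrite -lattice_pointD add0r addr0.
Qed.

(** A list with repetitions allowed: the exponent 0 may come both from [D] and from [t]. Exponents
    are stored negated, as [shape_op] reads them. *)
Definition shape_terms : seq (vec * C) := (0, - t) :: [seq (u, 1) | u <- D].

Lemma shape_termsE : shape_poly R D - laurent_const t = \sum_(s <- shape_terms) << s.2 *g - s.1 >>.
Proof. by rewrite big_cons big_map /= oppr0 monalgUN addrC. Qed.

Lemma shape_op_terms d w : shape_op D t d w = \sum_(s <- shape_terms) s.2 * d (w + s.1).
Proof.
rewrite big_cons big_map /= addr0 mulNr addrC; congr (_ + _).
by apply: eq_bigr => u _; rewrite mul1r.
Qed.

(** A crude common bound on the coordinates; adding it makes them nonnegative and turns Laurent
    polynomials into ordinary ones. *)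
Definition terms_bound : nat :=
  (\sum_(s <- shape_terms) (absz (axis_coord s.1) + absz (row_coord s.1)))%N.
Local Notation M := terms_bound.

Lemma terms_boundP s : s \in shape_terms ->
  0 <= axis_coord s.1 + M%:Z /\ 0 <= row_coord s.1 + M%:Z <= (M.*2)%:Z.
Proof.
move=> sS; have : (absz (axis_coord s.1) + absz (row_coord s.1) <= M)%N.
  rewrite /M; elim: shape_terms sS => [//|s' S IH]; rewrite inE big_cons.
  by case/orP => [/eqP->|/IH]; [exact: leq_addr | move=> h; apply: leq_trans h (leq_addl _ _)].
by move: (axis_coord _) (row_coord _) M => a b m; lia.
Qed.

Definition term_row (s : vec * C) : 'I_(M.*2).+1 := inord (absz (row_coord s.1 + M%:Z)%R).

(** The coefficient of [Y^b] when the operator, translated by [M] in both coordinates, is written as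
    a polynomial in the two shifts along the basis. *)
Definition row_poly (b : nat) : {poly C} :=
  \sum_(s <- shape_terms | term_row s == b :> nat) s.2 *: 'X^(absz (axis_coord s.1 + M%:Z)%R).

Lemma term_rowE s : s \in shape_terms -> (term_row s : nat)%:Z = row_coord s.1 + M%:Z.
Proof.
case/terms_boundP => _ /andP[ge le]; rewrite /term_row inordK ?gez0_abs // -addn1.
by move: (row_coord s.1 + M%:Z) le ge => x; lia.
Qed.

(** If every row polynomial vanished at [w], reduction modulo the binomial [X^k - w^-1], with
    [k = (k1, k2)], would collapse each row to a multiple of its value at [w], hence to zero, and
    the binomial would be a line factor. *)
Lemma row_poly_nondeg (w : C) : w != 0 -> exists2 b, (b < (M.*2).+1)%N & (row_poly b).[w] != 0.
Proof.
move=> w0; apply: contrapT => no_b; apply: no_line.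
have rowp0 (b : 'I_(M.*2).+1) : (row_poly b).[w] = 0.
  by apply/eqP/negP => /negP h; apply: no_b; exists b.
(* The eigenvalue is inverted because [f_D] carries the exponents [- u]. *)
exists (line_binomial (k1, k2) w^-1).
  apply: line_binomial_line; rewrite ?invr_eq0 //.
  apply/eqP => -[k10 k20]; have := bezout; rewrite k10 k20 !mulr0 addr0 => /eqP.
  by rewrite eq_sym oner_eq0.
rewrite shape_termsE.
(* The subtracted monomials are the reductions of the terms. They cancel row by row, and each
   difference is a multiple of the binomial. *)
have -> : \sum_(s <- shape_terms) << s.2 *g - s.1 >> =
    \sum_(s <- shape_terms) (<< s.2 *g - s.1 >> -
       << w ^ axis_coord s.1 * s.2 *g lattice_point 0 (- row_coord s.1) >>) :> laurent R.
  rewrite sumrB [X in _ - X](partition_big term_row xpredT) //= [X in _ - X]big1 ?subr0 // => b _.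
  rewrite big_seq_cond.
  rewrite (eq_bigr (fun s => << w ^ axis_coord s.1 * s.2 *g lattice_point 0 (M%:Z - b%:Z) >>)).
    rewrite -big_seq_cond malgU_sum (_ : \sum_(s <- _ | _) _ = w ^ (- M%:Z) * (row_poly b).[w]).
      by rewrite rowp0 mulr0 monalgU0.
    rewrite /row_poly horner_sum mulr_sumr big_seq_cond [RHS]big_seq_cond.
    apply: eq_bigr => s /andP[sS _]; rewrite hornerZ hornerXn exprnP.
    have [ge _] := terms_boundP sS; rewrite gez0_abs //.
    exact: exprz_rescale.
  have rowE (m r : int) : m - (r + m) = - r by ring.
  by move=> s /andP[sS /eqP <-]; rewrite term_rowE // rowE.
elim: shape_terms => [|s S IH]; first by rewrite big_nil; apply: laurent_dvd0.
rewrite big_cons; apply: laurent_dvdD => //.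
have := dvd_binomial (k1, k2) s.2 (lattice_point 0 (- row_coord s.1)) (- axis_coord s.1)
  (invr_neq0 w0).
rewrite exprz_inv opprK -lattice_pointE.
suff -> : lattice_point (- axis_coord s.1) (- row_coord s.1) = - s.1 by [].
apply/eqP; rewrite -addr_eq0 -[X in _ + X]lattice_pointK -lattice_pointD !addNr.
by rewrite /lattice_point !mul0r subr0.
Qed.

Lemma shape_op_eq0 (V : seq C) (d : vec -> C) (J0 : int) : (forall w, d w \in V) ->
  (forall w, J0 < row_coord w -> d w = 0) -> (forall w, shape_op D t d w = 0) -> forall w, d w = 0.
Proof.
move=> dV dhigh deq w; rewrite -[w]lattice_pointK; move: (row_coord w) (axis_coord w).
apply: (@rows_eq0 _ _ row_poly row_poly_nondeg V (fun j i => d (lattice_point i j)) J0) => //.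
  by move=> j i lt; apply: dhigh; rewrite row_coordK.
move=> j i; under eq_bigr do rewrite poly_act_sum.
(* The base point is translated by [M] in both coordinates to compensate the translation built into
   [row_poly]. *)
rewrite -[RHS](deq (lattice_point (i + M%:Z) (j + M%:Z))) shape_op_terms.
rewrite [RHS](partition_big term_row xpredT) //=; apply: eq_bigr => b _.
rewrite big_seq_cond [RHS]big_seq_cond; apply: eq_bigr => s /andP[sS /eqP sb].
rewrite -[in RHS](lattice_pointK s.1) -lattice_pointD -sb term_rowE //.
have [ge _] := terms_boundP sS; rewrite gez0_abs //.
by rewrite (addrAC i) (addrAC j) !addrA.
Qed.

End SingleFactor.

(** * Limits of colorings *)

Lemma exists_choice (X Y : Type) (P : X -> Y -> Prop) :
  (forall x, exists y, P x y) -> exists f, forall x, P x (f x).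
Proof. by case/choice => f fP; exists f. Qed.

(** Limits along one fixed [U] exist at all cells at once and decide every alternative, so no
    subsequences need to be extracted. *)
Record free_ultrafilter (U : (nat -> Prop) -> Prop) : Prop := FreeUltrafilter {
  ultraS : forall P Q : nat -> Prop, (forall k, P k -> Q k) -> U P -> U Q;
  ultraI : forall P Q : nat -> Prop, U P -> U Q -> U (fun k => P k /\ Q k);
  ultra_em : forall P : nat -> Prop, U P \/ U (fun k => ~ P k);
  ultraN0 : ~ U (fun=> False);
  ultra_large : forall n, U (fun k => (n <= k)%N) }.

Lemma free_ultrafilter_exists : exists U, free_ultrafilter U.
Proof.
have [U [FU sub]] := ultraFilterLemma eventually_filter.
exists U; split.
- by move=> P Q PQ; apply: filterS.
- by move=> P Q; apply: filterI.
- by move=> P; have := @in_ultra_setVsetC _ U P FU.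
- exact: filter_not_empty.
- by move=> n; apply: sub; exists n.
Qed.

Section Ultra.
Variable U : (nat -> Prop) -> Prop.
Hypothesis FU : free_ultrafilter U.

Lemma ultraT (P : nat -> Prop) : (forall k, P k) -> U P.
Proof. by move=> h; apply: (ultraS FU _ (ultra_large FU 0)) => k _. Qed.

Lemma ultra_ex P : U P -> exists k, P k.
Proof.
move=> UP; apply: contrapT => no; apply: (ultraN0 FU); apply: (ultraS FU _ UP) => k Pk.
by apply: no; exists k.
Qed.

Lemma ultra_all (T : eqType) (s : seq T) (P : T -> nat -> Prop) :
  (forall x, x \in s -> U (P x)) -> U (fun k => forall x, x \in s -> P x k).
Proof.
elim: s => [|x s IH] h; first exact: ultraT.
have hx := h x (mem_head _ _); have hs : U (fun k => forall y, y \in s -> P y k).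
  by apply: IH => y ys; apply: h; rewrite inE ys orbT.
apply: (ultraS FU _ (ultraI FU hx hs)) => k [Px Ps] y.
by rewrite inE => /orP[/eqP->|/Ps].
Qed.

(** The alphabet is finite: if no letter were taken on a [U]-large set, all letters would be avoided
    simultaneously. *)
Lemma ultra_limit (n : nat) (c : nat -> config n) :
  exists c' : config n, forall u, U (fun k => c k u = c' u).
Proof.
apply: (@exists_choice vec 'I_n (fun u i => U (fun k => c k u = i))) => u; apply: contrapT => no.
have : U (fun k => forall i : 'I_n, i \in enum 'I_n -> c k u <> i).
  apply: ultra_all => i _; have [] := ultra_em FU (fun k => c k u = i) => // h.
  by case: no; exists i.
case/ultra_ex => k /(_ (c k u)); rewrite mem_enum => /(_ isT); exact.
Qed.

End Ultra.

(** * Local legality and balls of agreement *)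

Section Local.
Variables (n : nat) (D : {fset vec}) (B : 'M[nat]_n).
Implicit Types (c : config n).

Definition neighbours c (u : vec) (i : 'I_n) : nat := (\sum_(d <- D) (c (u + d)%R == i))%N.

Definition legal_at c (u : vec) := forall i, neighbours c u i = B i (c u).

Lemma card_neighbours c u i :
  #|` [fset v in [fset (u + d)%R | d in D] | c v == i]%fset| = neighbours c u i.
Proof.
have -> : [fset v in [fset (u + d)%R | d in D] | c v == i]%fset =
    ((fun d => u + d)%R @` [fset d in D | c (u + d)%R == i])%fset.
  apply/fsetP => v; rewrite !inE /=; apply/idP/idP.
    by case/andP => /imfsetP[/= d dD ->] cv; apply: in_imfset; rewrite !inE dD.
  case/imfsetP => /= d; rewrite !inE => /andP[dD cd] ->.
  by rewrite cd andbT; apply: in_imfset.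
rewrite card_imfset /=; last exact: addrI.
rewrite card_fset_sum1 -big_fset_condE /neighbours big_mkcond /=.
by apply: eq_bigr => d _; case: eqP.
Qed.

Lemma coloringP c : coloring D B c <-> forall u, legal_at c u.
Proof.
split=> [h u i|h i j u <-]; first by rewrite -card_neighbours; apply: h.
by rewrite card_neighbours h.
Qed.

Lemma legal_at_local c c' u u' : c u = c' u' -> (forall d, d \in D -> c (u + d) = c' (u' + d)) ->
  legal_at c u -> legal_at c' u'.
Proof.
move=> e h lc i; rewrite -e -lc; rewrite /neighbours !big_seq.
by apply: eq_bigr => d dD; rewrite h.
Qed.

Lemma coloring_shift c v : coloring D B c -> coloring D B (fun u => c (u + v)).
Proof.
move/coloringP => h; apply/coloringP => u; apply: legal_at_local (h (u + v)) => // d _.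
by rewrite addrAC.
Qed.

(** Legality at [u] reads only [u] and [u + D]; on these finitely many cells some [c k] that is
    legal at [u] agrees with the limit. *)
Lemma ultra_limit_legal U (FU : free_ultrafilter U) (c : nat -> config n) c' :
  (forall u, U (fun k => c k u = c' u)) -> (forall u, U (fun k => legal_at (c k) u)) ->
  coloring D B c'.
Proof.
move=> lim leg; apply/coloringP => u.
have ld : U (fun k => forall d, d \in enum_fset D -> c k (u + d) = c' (u + d)).
  by apply: ultra_all => // d _; apply: lim.
have [k [[l1 l2] l3]] := ultra_ex FU (ultraI FU (ultraI FU (lim u) (leg u)) ld).
exact: legal_at_local l2.
Qed.

(** Balls are Euclidean so that growing balls, recentred at boundary points, flatten into
    half-planes. *)
Definition normsq (v : vec) : nat := (absz v.1 ^ 2 + absz v.2 ^ 2)%N.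

(** The square of half-side [r] contains all points with [normsq] at most [r], as an integer is
    bounded by its square; its patterns form a finite type. *)
Definition ball_pattern (r : nat) c : {ffun 'I_r.*2.+1 * 'I_r.*2.+1 -> 'I_n} :=
  [ffun x : 'I_r.*2.+1 * 'I_r.*2.+1 => c ((x.1 : nat)%:Z - r%:Z, (x.2 : nat)%:Z - r%:Z)].

Lemma ball_patternP r c c' u : ball_pattern r c = ball_pattern r c' ->
  (normsq u <= r)%N -> c u = c' u.
Proof.
case: u => x y e le; have [bx by_] : (absz x <= r)%N /\ (absz y <= r)%N.
  by move: le; rewrite /normsq /=; move: (absz x) (absz y) => a b le; split; nia.
have lx : (absz (x + r%:Z)%R < r.*2.+1)%N by lia.
have ly : (absz (y + r%:Z)%R < r.*2.+1)%N by lia.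
have := congr1 (fun f : {ffun _ -> 'I_n} => f (Ordinal lx, Ordinal ly)) e; rewrite !ffunE /=.
by rewrite !gez0_abs ?addrK //; lia.
Qed.

Definition determined_by_ball (r : nat) : Prop := forall c c', coloring D B c -> coloring D B c' ->
  (forall u, (normsq u <= r)%N -> c u = c' u) -> c = c'.

Lemma determined_finite r : determined_by_ball r ->
  finite_set [set c : config n | coloring D B c]%classic.
Proof.
move=> det; set X := [set c | _]%classic.
have [->|/set0P[c0 Xc0]] := eqVneq X set0; first exact: finite_set0.
have [f fP] : exists f, forall p, forall c, X c -> ball_pattern r c = p -> f p = c.
  apply: (@exists_choice _ (config n)
    (fun p c' => forall c, X c -> ball_pattern r c = p -> c' = c)) => p.
  have [[c [Xc cp]]|no_c] := pselect (exists c, X c /\ ball_pattern r c = p).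
    by exists c => c' Xc' c'p; apply: det => // u; apply: ball_patternP; rewrite cp.
  by exists c0 => c Xc cp; case: no_c; exists c.
apply: (@sub_finite_set _ _ (f @` setT)%classic); last exact/finite_image/finite_finset.
by move=> c Xc; exists (ball_pattern r c) => //; apply: fP.
Qed.

(** Translates of a coloring are colorings, so two of the translates by the first [#|T|.+1]
    multiples of [v] share their ball pattern and coincide. The period found divides the factorial
    of [#|T|], whatever [c] and [v] are. *)
Lemma determined_period r : determined_by_ball r ->
  exists2 k, (0 < k)%N & forall c, coloring D B c -> forall u v, c (u + v *+ k) = c u.
Proof.
move=> det; pose T := {ffun 'I_r.*2.+1 * 'I_r.*2.+1 -> 'I_n}.
exists (#|T|)`!; first exact: fact_gt0.
move=> c cX u v; pose f (j : 'I_#|T|.+1) : T := ball_pattern r (fun w => c (w + v *+ j)).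
have /injectivePn[i [j ne eq_f]] : ~~ injectiveb f.
  by apply/negP => /injectiveP/leq_card; rewrite card_ord ltnn.
wlog lt : i j ne eq_f / (i < j)%N => [H|].
  have [lt|gt|/val_inj e] := ltngtP i j; [exact: (H i j)| |by rewrite e eqxx in ne].
  by apply: (H j i) => //; rewrite eq_sym.
have eq_c : (fun w => c (w + v *+ i)) = (fun w => c (w + v *+ j)).
  apply: det; [exact: coloring_shift | exact: coloring_shift |].
  by move=> w; apply: (ball_patternP eq_f).
have per w : c (w + v *+ (j - i)) = c w.
  have := congr1 (fun c' : config n => c' (w - v *+ i)) eq_c.
  by rewrite subrK => ->; rewrite mulrnBr 1?ltnW // addrA addrAC.
have /dvdnP[q ->] : (j - i %| (#|T|)`!)%N.
  by rewrite dvdn_fact // subn_gt0 lt (leq_trans (leq_subr _ _)) // -ltnS.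
elim: q => [|q IH]; first by rewrite mul0n mulr0n addr0.
by rewrite mulSn mulrnDr addrCA addrC per.
Qed.

Lemma minimal_disagreement (c c' : config n) : c <> c' ->
  exists v, c v <> c' v /\ forall u, (normsq u < normsq v)%N -> c u = c' u.
Proof.
move=> ne; have [v0 dv0] : exists v, c v <> c' v.
  apply: contrapT => no; apply: ne; apply: funext => v.
  by apply: contrapT => h; apply: no; exists v.
have ex : exists m, `[< exists v, c v <> c' v /\ normsq v = m >].
  by exists (normsq v0); apply/asboolP; exists v0.
case: (ex_minnP ex) => m /asboolP[v [dv <-]] vmin; exists v; split=> // u lt.
apply: contrapT => du; move: lt; rewrite ltnNge => /negP; apply.
by apply: vmin; apply/asboolP; exists u.
Qed.

Definition dotp (u v : vec) : int := u.1 * v.1 + u.2 * v.2.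

Lemma normsqD (u v : vec) : (normsq (u + v))%:Z = (normsq u)%:Z + dotp u v *+ 2 + (normsq v)%:Z.
Proof.
have sqE (x : int) : (absz x ^ 2)%N%:Z = x ^+ 2 by rewrite -abszX gez0_abs // sqr_ge0.
by rewrite /normsq /dotp !PoszD !sqE /=; ring.
Qed.

(* After recentring at [v k], the ball of agreement of the [k]-th pair is the set of the [u]
   such that [2 <u, v k> + |u|^2 < 0]. *)
Lemma asymptotic_pair : (forall r, ~ determined_by_ball r) ->
  exists U (v : nat -> vec) (a b : config n),
    [/\ free_ultrafilter U, coloring D B a /\ coloring D B b, a 0 <> b 0,
     forall k, (k < normsq (v k))%N &
     forall u, U (fun k => dotp u (v k) *+ 2 + (normsq u)%:Z < 0) -> a u = b u].
Proof.
move=> undet; have [U FU] := free_ultrafilter_exists.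
(* The third component is a point of least norm where the two colorings differ; it lies outside the
   ball given by [k], so these norms tend to infinity. *)
pose good (k : nat) (s : config n * config n * vec) :=
  [/\ coloring D B s.1.1 /\ coloring D B s.1.2, s.1.1 s.2 <> s.1.2 s.2,
     (k < normsq s.2)%N & forall u, (normsq u < normsq s.2)%N -> s.1.1 u = s.1.2 u].
have [s sP] : exists s, forall k, good k (s k).
  apply: exists_choice => k.
  have /existsNP[c /existsNP[c' /not_implyP[Xc /not_implyP[Xc' /not_implyP[agree ne]]]]] := undet k.
  have [v [dv vmin]] := minimal_disagreement ne; exists (c, c', v); split=> //=.
  by rewrite ltnNge; apply/negP => /agree.
have [a aP] := ultra_limit FU (fun k u => (s k).1.1 (u + (s k).2)).
have [b bP] := ultra_limit FU (fun k u => (s k).1.2 (u + (s k).2)).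
exists U, (fun k => (s k).2), a, b; split=> //.
- split; [apply: (ultra_limit_legal FU aP) | apply: (ultra_limit_legal FU bP)] => u;
    apply: (ultraT FU) => k; have [[h1 h2] _ _ _] := sP k.
    by move: u; apply/coloringP/coloring_shift.
  by move: u; apply/coloringP/coloring_shift.
- have [k [ea eb]] := ultra_ex FU (ultraI FU (aP 0) (bP 0)).
  by rewrite -ea -eb /= !add0r; have [] := sP k.
- by move=> k; have [] := sP k.
- move=> u Uu; have [k [[ea eb] lt]] := ultra_ex FU (ultraI FU (ultraI FU (aP u) (bP u)) Uu).
  rewrite -ea -eb; have [_ _ _] := sP k; apply.
  by rewrite -ltz_nat normsqD gtrDr [_ + dotp _ _ *+ 2]addrC.
Qed.

End Local.

(** * Colorings are determined by a ball *)

Section Difference.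
Variables (C : numClosedFieldType) (n : nat) (D : {fset vec}) (B : 'M[nat]_n.+1).
Variables (a b : config n.+1).
Hypotheses (aX : coloring D B a) (bX : coloring D B b).

Definition config_diff (i : 'I_n.+1) (w : vec) : C := (a w == i)%:R - (b w == i)%:R.

Local Notation Bc := (map_mx (GRing.natmul (1 : C)) B).

Lemma sum_indicator (F : 'I_n.+1 -> C) k : \sum_j F j * (k == j)%:R = F k.
Proof.
rewrite (bigD1 k) //= eqxx mulr1 big1 ?addr0 // => j /negPf ne.
by rewrite eq_sym ne mulr0.
Qed.

(** The coloring condition is linear in the indicators of the letters: on their vector [f_D] acts as
    the matrix [B]. *)
Lemma shape_op_diff (t : C) i w :
  shape_op D t (config_diff i) w = \sum_j (Bc - t%:M) i j * config_diff j w.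
Proof.
have nb c : coloring D B c -> \sum_(u <- D) (c (w + u) == i)%:R = Bc i (c w) :> C.
  by rewrite mxE => /coloringP/(_ w i) <-; rewrite natr_sum.
rewrite /shape_op sumrB !nb //.
under eq_bigr do rewrite mulrBr; rewrite sumrB !(sum_indicator (fun j => (Bc - t%:M) i j)).
rewrite /config_diff !mxE ![_ == i]eq_sym; case: eqP; case: eqP => _ _ /=; ring.
Qed.

Lemma prod_shape_op_diff (rs : seq C) i w :
  foldr (shape_op D) (config_diff i) rs w =
  \sum_j horner_mx Bc (\prod_(z <- rs) ('X - z%:P)) i j * config_diff j w.
Proof.
elim: rs w => [|z rs IH] w /=.
  by rewrite big_nil rmorph1 (eq_bigr (fun j => config_diff j w * (i == j)%:R)) ?sum_indicator //
    => j _; rewrite mxE mulrC.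
rewrite (funext IH) /shape_op.
rewrite exchange_big mulr_sumr -sumrB /=.
rewrite big_cons mulrC rmorphM rmorphB /= horner_mx_X horner_mx_C.
set M := horner_mx _ _.
under [RHS]eq_bigr do rewrite mxE mulr_suml.
rewrite [RHS]exchange_big /=; apply: eq_bigr => j _.
under [RHS]eq_bigr do rewrite -mulrA.
by rewrite -[RHS]mulr_sumr -shape_op_diff /shape_op [RHS]mulrBr mulr_sumr [in RHS]mulrCA.
Qed.

(** The roots of the characteristic polynomial serve: their product kills the differences by
    Cayley-Hamilton, and the determinant condition says that [t0] is not an eigenvalue. *)
Lemma char_poly_roots (t0 : int) : \det (map_mx Posz B - t0%:M) != 0 ->
  exists2 rs : seq C, t0%:~R \notin rs & forall i w, foldr (shape_op D) (config_diff i) rs w = 0.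
Proof.
move=> det0; have [rs rsE] := closed_field_poly_normal (char_poly Bc).
rewrite (monicP (char_poly_monic _)) scale1r in rsE; exists rs; last first.
  move=> i w; rewrite prod_shape_op_diff -rsE Cayley_Hamilton.
  by apply: big1 => j _; rewrite mxE mul0r.
rewrite -root_prod_XsubC -rsE -eigenvalue_root_char; apply/negP => /eigenvalueP[v vB v0].
have detE : \det (Bc - (t0%:~R)%:M) != 0.
  rewrite (_ : Bc - _ = map_mx intr (map_mx Posz B - t0%:M)).
    by rewrite det_map_mx intr_eq0.
  by rewrite map_mxB map_scalar_mx; congr (_ - _); apply/matrixP => x y; rewrite !mxE.
have : v *m (Bc - (t0%:~R)%:M) = 0 by rewrite mulmxBr vB mul_mx_scalar subrr.
have un : Bc - (t0%:~R)%:M \in unitmx by rewrite unitmxE unitfE.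
by move/(congr1 (mulmx^~ (invmx (Bc - (t0%:~R)%:M)))); rewrite mulmxK // mul0mx => /eqP; apply/negP.
Qed.

End Difference.

Section FiniteRange.
Variables (C : nzRingType) (D : {fset vec}).

Lemma finite_range_sum (T : Type) (r : seq T) (V : seq C) :
  exists W : seq C, forall f : T -> C, (forall x, f x \in V) -> \sum_(x <- r) f x \in W.
Proof.
elim: r => [|x r [W WP]]; first by exists [:: 0] => f _; rewrite big_nil mem_head.
exists [seq y + z | y <- V, z <- W] => f fV; rewrite big_cons.
by apply: (allpairs_f (fun y z => y + z)) => //; apply: WP.
Qed.

(** Finiteness of the range, demanded by [shape_op_eq0], survives each factor. *)
Lemma finite_range_shape_op t (V : seq C) : exists W : seq C, forall d : vec -> C,
  (forall w, d w \in V) -> forall w, shape_op D t d w \in W.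
Proof.
have [W WP] := finite_range_sum D V; exists [seq y - t * z | y <- W, z <- V] => d dV w.
by apply: (allpairs_f (fun y z => y - t * z)) => //; apply: WP.
Qed.

End FiniteRange.

Lemma bounded_on_seq (T : eqType) (s : seq T) (f : T -> int) :
  exists M : nat, forall x, x \in s -> (absz (f x) <= M)%N.
Proof.
elim: s => [|x s [M MP]]; first by exists 0%N.
exists (maxn (absz (f x)) M) => y; rewrite inE => /orP[/eqP->|/MP le]; first exact: leq_maxl.
exact: leq_trans le (leq_maxr _ _).
Qed.

(** * Asymptotic pairs: two colorings that agree on a limit half-plane *)

Section HalfPlane.
Variables (R : realType) (n : nat) (D : {fset vec}) (B : 'M[nat]_n.+1) (t0 : int).
Local Notation C := (R[i]).
Hypothesis no_line :
  forall t : C, t != t0%:~R -> ~ has_line_factor (shape_poly R D - laurent_const t).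
Hypothesis det0 : \det (map_mx Posz B - t0%:M) != 0.
Variables (a b : config n.+1).
Hypotheses (aX : coloring D B a) (bX : coloring D B b) (ab0 : a 0 <> b 0).
Variables (U : (nat -> Prop) -> Prop) (v : nat -> vec).
Hypotheses (FU : free_ultrafilter U) (vlarge : forall k, (k < normsq (v k))%N).

(** The half-plane is described by the growth of inner products along [U], which is finer than a
    limit normal: a direction orthogonal to that normal may still be far inside. *)
Definition far_inside (w : vec) := forall m : nat, U (fun k => dotp w (v k) < - m%:Z).
Definition near_boundary (w : vec) := exists m : nat, U (fun k => (absz (dotp w (v k)) <= m)%N).

Hypothesis agree : forall w, far_inside w -> a w = b w.

Lemma dotpDl x y z : dotp (x + y) z = dotp x z + dotp y z.
Proof. by rewrite /dotp /=; ring. Qed.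

Lemma dotpNl x z : dotp (- x) z = - dotp x z.
Proof. by rewrite /dotp /=; ring. Qed.

(** Inner products that are not bounded along [U] exceed every bound along [U], and with a constant
    sign. *)
Lemma far_or_near w : far_inside w \/ near_boundary w \/ far_inside (- w).
Proof.
have [|nn] := pselect (near_boundary w); first by right; left.
have nU (m : nat) : U (fun k => ~ (absz (dotp w (v k)) <= m)%N).
  by have [h|] := ultra_em FU (fun k => (absz (dotp w (v k)) <= m)%N) => //; case: nn; exists m.
have [neg|pos] := ultra_em FU (fun k => dotp w (v k) < 0).
  left=> m; apply: (ultraS FU _ (ultraI FU neg (nU m))) => k; lia.
right; right=> m; apply: (ultraS FU _ (ultraI FU pos (nU m))) => k.
by rewrite dotpNl; lia.
Qed.

Lemma far_insideD x y : far_inside x -> far_inside y -> far_inside (x + y).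
Proof.
move=> fx fy m; apply: (ultraS FU _ (ultraI FU (fx m) (fy m))) => k.
by rewrite dotpDl; lia.
Qed.

Lemma not_all_near : ~ (near_boundary (1, 0) /\ near_boundary (0, 1)).
Proof.
move=> [[m1 h1] [m2 h2]]; have [k [[l1 l2] lk]] := ultra_ex FU (ultraI FU (ultraI FU h1 h2)
  (ultra_large FU (m1 ^ 2 + m2 ^ 2)%N)).
have := vlarge k; rewrite ltnNge => /negP; apply; apply: leq_trans lk.
move: l1 l2; rewrite /dotp /= !mul1r !mul0r addr0 add0r => l1 l2.
by rewrite leq_add // leq_exp2r.
Qed.

(** Confronts an invariant with the annihilating product of [char_poly_roots]: each of its factors
    has [t != t0], so the invariant would reach the zero function. *)
Lemma no_product_kills (P : (vec -> C) -> Prop) :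
  (forall d, P d -> exists w, d w != 0) ->
  (forall t d, t != t0%:~R -> P d -> P (shape_op D t d)) ->
  P (config_diff C a b (a 0)) -> False.
Proof.
move=> Pnz Pstep P0; have [rs rs0 kill] := char_poly_roots C aX bX det0.
have : P (foldr (shape_op D) (config_diff C a b (a 0)) rs).
  elim: rs rs0 {kill} => [//|z rs IH]; rewrite inE negb_or => /andP[z0 rs0] /=.
  by apply: Pstep (IH rs0); rewrite eq_sym.
by case/Pnz => w; rewrite kill eqxx.
Qed.

Lemma config_diff_origin : config_diff C a b (a 0) 0 != 0.
Proof.
have /negPf ne : b 0 != a 0 by apply/eqP => /esym.
by rewrite /config_diff eqxx ne subr0 oner_eq0.
Qed.

Lemma config_diff_far i w : far_inside w -> config_diff C a b i w = 0.
Proof. by move/agree => e; rewrite /config_diff e subrr. Qed.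

(** Unlike [shape_terms], the support lists each exponent once, so an extreme monomial has a nonzero
    coefficient. *)
Lemma shape_op_laurent t (d : vec -> C) w (f := shape_poly R D - laurent_const t) :
  shape_op D t d w = \sum_(u <- msupp f) f@_u * d (w - u).
Proof.
rewrite shape_op_terms -/(mmap idfun (fun u => d (w - u)) f) /f shape_termsE.
rewrite raddf_sum; apply: eq_bigr => s _.
by rewrite /= mmapU opprK.
Qed.

Lemma laurent_nonzero t : t != t0%:~R -> shape_poly R D - laurent_const t != 0.
Proof.
move=> tt0; apply/eqP => f0; apply: (no_line tt0); rewrite f0.
exists (line_binomial (1, 0) 1); last exact: laurent_dvd0.
by apply: line_binomial_line; rewrite ?oner_eq0.
Qed.

(** Otherwise [far_inside] is the positive cone of a total group order on the lattice. A function
    with an extreme nonzero point keeps one under [f_D - t], as in a product of leading terms. *)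
Lemma some_near : exists2 w, w != 0 & near_boundary w.
Proof.
apply: contrapT => none.
have total (w : vec) : w != 0 -> far_inside w \/ far_inside (- w).
  move=> w0; have [|[nw|]] := far_or_near w; [by left| |by right].
  by case: none; exists w.
apply: (@no_product_kills (fun d => exists2 w0, d w0 != 0 &
  forall w, far_inside w -> d (w0 + w) = 0)).
- by move=> d [w0 dw0 _]; exists w0.
- move=> t d tt0 [w0 dw0 dfar].
  set f := shape_poly R D - laurent_const t.
  (* [u0] is the extreme exponent of [f] for this order. *)
  have [u0 u0f u0max] : exists2 u0, u0 \in enum_fset (msupp f) &
      forall u, u \in enum_fset (msupp f) -> u != u0 -> far_inside (u0 - u).
    have : enum_fset (msupp f) != [::].
      apply/eqP => e0; have /eqP[] := laurent_nonzero tt0.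
      by rewrite -/f (monalgE f) e0 big_nil.
    elim: (enum_fset _) => [//|x s IH] _; have [->|/IH[y ys ymax]] := eqVneq s [::].
      by exists x; rewrite ?mem_head // => u; rewrite inE => ->.
    have [xy|ne] := eqVneq x y.
      exists y; first by rewrite inE ys orbT.
      by move=> u; rewrite inE xy => /orP[/eqP-> /eqP//|]; apply: ymax.
    have [fyx|fxy] : far_inside (y - x) \/ far_inside (x - y).
      by rewrite -[x - y]opprB; apply: total; rewrite subr_eq0 eq_sym.
    - exists y; first by rewrite inE ys orbT.
      by move=> u; rewrite inE => /orP[/eqP->|] //; apply: ymax.
    - exists x; first exact: mem_head.
      move=> u; rewrite inE => /orP[/eqP-> /eqP//|us _].
      have [->//|uy] := eqVneq u y.
      by rewrite -(subrKA y); apply: far_insideD => //; apply: ymax.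
  (* Here the monomial [u0] reads [d w0], and any other [u] reads [d] at [w0 + (u0 - u)], where it
     vanishes. *)
  exists (w0 + u0).
    rewrite shape_op_laurent (big_rem u0) //= addrK big_seq big1 ?addr0.
      by rewrite mulf_neq0 // mcoeff_neq0.
    move=> u; rewrite mem_rem_uniq ?fset_uniq // inE => /andP[ne uf].
    by rewrite -addrA dfar ?mulr0 //; apply: u0max.
  move=> w fw; rewrite shape_op_laurent big_seq big1 // => u uf.
  rewrite (_ : _ - u = w0 + (u0 - u + w)); last by rewrite -!addrA [w - u]addrC.
  have [->|ne] := eqVneq u u0; first by rewrite subrr add0r dfar ?mulr0.
  by rewrite dfar ?mulr0 //; apply: far_insideD => //; apply: u0max.
- exists 0; first exact: config_diff_origin.
  by move=> w; rewrite add0r; apply: config_diff_far.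
Qed.

(** Dividing a boundary vector by the gcd of its coordinates only shrinks its inner products. *)
Lemma primitive_near : exists k1 k2 p q : int, p * k1 + q * k2 = 1 /\ near_boundary (k1, k2).
Proof.
have [[x y] w0 [m Um]] := some_near.
have [p [q bez]] := Bezoutz x y.
have g0 : gcdz x y != 0 by rewrite gcdz_eq0; apply: contraNN w0 => /andP[/eqP-> /eqP->].
have [k1 xE] := dvdzP (dvdz_gcdl x y); have [k2 yE] := dvdzP (dvdz_gcdr x y).
exists k1, k2, p, q; split.
  by apply: (mulIf g0); rewrite mul1r mulrDl -!mulrA -xE -yE.
exists m; apply: (ultraS FU _ Um) => k; apply: leq_trans.
rewrite (_ : dotp (x, y) (v k) = gcdz x y * dotp (k1, k2) (v k)).
  by rewrite abszM leq_pmull // absz_gt0.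
by move: (gcdz x y) xE yE => g -> ->; rewrite /dotp /=; ring.
Qed.

(** Moving along a row changes the inner products by a bounded amount, so the row index alone
    decides. *)
Lemma far_lattice_point k1 k2 p q : near_boundary (k1, k2) ->
  far_inside (lattice_point k1 k2 p q 0 1) ->
  forall i j, 0 < j -> far_inside (lattice_point k1 k2 p q i j).
Proof.
move=> [m Um] far i j j0 m'.
apply: (ultraS FU _ (ultraI FU Um (far (m' + absz i * m)%N))) => k.
have -> : dotp (lattice_point k1 k2 p q i j) (v k) =
    i * dotp (k1, k2) (v k) + j * dotp (lattice_point k1 k2 p q 0 1) (v k).
  by rewrite /dotp /lattice_point /=; ring.
move: (dotp _ _) (dotp _ _) => Y X [leX ltY].
have h1 : i * X <= (absz i * m)%N%:Z.
  apply: le_trans (ler_norm _) _; rewrite -abszE abszM lez_nat.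
  by rewrite leq_mul2l leX orbT.
move: (absz i * m)%N (i * X) h1 ltY => c iX h1 ltY; have h2 : j * Y <= Y by nia.
by move: (j * Y) h2 => jY; lia.
Qed.

Lemma near_lattice_absurd k1 k2 p q : p * k1 + q * k2 = 1 -> near_boundary (k1, k2) ->
  ~ near_boundary (lattice_point k1 k2 p q 0 1).
Proof.
move=> bez [m1 U1] [m2 U2].
have near w : near_boundary w.
  exists (absz (axis_coord p q w) * m1 + absz (row_coord k1 k2 w) * m2)%N.
  apply: (ultraS FU _ (ultraI FU U1 U2)) => k [l1 l2].
  rewrite -{1}(lattice_pointK bez w).
  have -> (i j : int) : dotp (lattice_point k1 k2 p q i j) (v k) =
      i * dotp (k1, k2) (v k) + j * dotp (lattice_point k1 k2 p q 0 1) (v k).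
    by rewrite /dotp /lattice_point /=; ring.
  have tri (x y : int) : (absz (x + y)%R <= absz x + absz y)%N by lia.
  apply: leq_trans (tri _ _) _.
  by rewrite !abszM leq_add // leq_mul2l ?l1 ?l2 orbT.
by apply: not_all_near.
Qed.

(** In the basis of a primitive boundary direction, the colorings agree on all rows of positive
    index. By [shape_op_eq0], no factor kills a nonzero function of finite range that vanishes on
    high rows. *)
Lemma no_asymptotic_pair : False.
Proof.
have [k1 [k2 [p [q [bez near]]]]] := primitive_near.
(* Negating [k1], [k2], [p] and [q] keeps the Bezout relation and reverses the order of the rows. *)
wlog far : k1 k2 p q bez near / far_inside (lattice_point k1 k2 p q 0 1).
  move=> H; have [|[nr|far]] := far_or_near (lattice_point k1 k2 p q 0 1).
  - exact: H bez near.
  - exact: (near_lattice_absurd bez near nr).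
  - apply: (H (- k1) (- k2) (- p) (- q)); first by rewrite !mulrNN.
      have [m Um] := near; exists m; apply: (ultraS FU _ Um) => k.
      by rewrite (_ : (- k1, - k2) = - (k1, k2)) // dotpNl abszN.
    rewrite (_ : lattice_point _ _ _ _ _ _ = - lattice_point k1 k2 p q 0 1) //.
    by rewrite /lattice_point; congr pair => /=; ring.
have farij := far_lattice_point near far.
apply: (@no_product_kills (fun d => [/\ exists V : seq C, forall w, d w \in V,
   exists J0 : int, forall w, J0 < row_coord k1 k2 w -> d w = 0 & exists w, d w != 0])).
- by move=> d [].
- move=> t d tt0 [[V dV] [J0 dhigh] [w dw]]; split.
  + by have [W WP] := finite_range_shape_op D t V; exists W; apply: WP.
  + have [M MP] := bounded_on_seq (enum_fset D) (row_coord k1 k2).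
    (* The cells [x + u] lie at most [M] rows below [x]. *)
    exists (J0 + M%:Z) => x lt; rewrite /shape_op big_seq big1 => [|u uD].
      by rewrite dhigh ?mulr0 ?subr0 //; lia.
    apply: dhigh; have := MP u uD.
    have -> : row_coord k1 k2 (x + u) = row_coord k1 k2 x + row_coord k1 k2 u.
      by rewrite /row_coord /=; ring.
    by move: (row_coord _ _ x) (row_coord _ _ u) lt => ? ?; lia.
  + apply: contrapT => none; move/eqP: dw; apply.
    apply: (shape_op_eq0 bez (no_line tt0) dV dhigh) => x.
    by apply/eqP/negP => /negP h; apply: none; exists x.
- split.
  + exists [:: 0 - 0; 0 - 1; 1 - 0; 1 - 1] => w; rewrite /config_diff !inE.
    move: (a 0) => i0.
    by case: (a w == i0); case: (b w == i0); rewrite eqxx ?orbT.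
  + exists 0 => w lt; apply: config_diff_far.
    by rewrite -(lattice_pointK bez w); apply: farij.
  + by exists 0; apply: config_diff_origin.
Qed.

End HalfPlane.

Lemma admissible_determined (R : realType) (n : nat) (D : {fset vec}) (B : 'M[nat]_n) (t0 : int) :
  admissible R D B t0 -> exists r, determined_by_ball D B r.
Proof.
case: n B => [|n] B [no_line det0]; first by exists 0%N => c; case: (c 0).
apply: contrapT => /forallNP/asymptotic_pair[U [v [a [b [FU [aX bX] ab0 vlarge agree]]]]].
apply: (no_asymptotic_pair no_line det0 aX bX ab0 FU vlarge) => w far.
(* Being below [- normsq w] makes twice the inner product plus [normsq w] negative, except possibly
   when [normsq w] is 0, where strictness suffices. *)
apply: agree; apply: (ultraS FU _ (far (normsq w))) => k; lia.
Qed.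

(** * Computable functions *)

Local Open Scope nat_scope.

(** Walks along the antidiagonals in the order in which [cpair] numbers them. *)
Fixpoint unpair (x : nat) : nat * nat :=
  if x is y.+1 then
    let: (a, b) := unpair y in if a is a'.+1 then (a', b.+1) else (b.+1, 0)
  else (0, 0).

Definition pl x := (unpair x).1.
Definition pr x := (unpair x).2.

Lemma plprK x : cpair (pl x) (pr x) = x.
Proof.
rewrite /pl /pr; elim: x => [//|x]; rewrite /=; case: (unpair x) => [[|a] b] /= <-.
  by rewrite /cpair !addn0 add0n [LHS]binS bin1 addnS.
by rewrite /cpair addnS addSn addnS.
Qed.

Lemma plK a b : pl (cpair a b) = a.
Proof. by have [] := cpair_inj (plprK (cpair a b)). Qed.

Lemma prK a b : pr (cpair a b) = b.
Proof. by have [] := cpair_inj (plprK (cpair a b)). Qed.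

Definition computable (f : nat -> nat) : Prop := exists e, forall x, eval e x (f x).

Fixpoint prim_rec (a : nat) (g : nat -> nat -> nat) (n : nat) : nat :=
  if n is m.+1 then g m (prim_rec a g m) else a.

Lemma eq_computable f g : (forall x, f x = g x) -> computable g -> computable f.
Proof. by move=> fg [e eP]; exists e => x; rewrite fg. Qed.

Lemma sum_ltn_ord m q : \sum_(i < m) (i < q) = minn m q.
Proof. by elim: m => [|m IH]; rewrite ?big_ord0 ?min0n // big_ord_recr /= IH; lia. Qed.

(** Named so that the tactic below recognises bounded sums and quantifiers by their head symbols. *)
Definition bsum (n : nat) (F : nat -> nat) : nat := \sum_(i < n) F i.
Definition bforall (n : nat) (P : nat -> bool) : bool := [forall i : 'I_n, P i].

Section Closure.
Implicit Types (f g h : nat -> nat) (p q : nat -> bool).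

Lemma computable_id : computable (fun x => x).
Proof.
exists (Pair Left Right) => x; rewrite -[x in eval _ _ x]plprK -{1}[x]plprK.
by apply: eval_pair; constructor.
Qed.

Lemma computable_comp f g : computable f -> computable g -> computable (fun x => f (g x)).
Proof. by move=> [e eP] [e' eP']; exists (Comp e e') => x; apply: eval_comp (eP' x) (eP _). Qed.

Lemma computable_succ f : computable f -> computable (fun x => (f x).+1).
Proof. by apply: (@computable_comp succn); exists Succ => x; constructor. Qed.

Lemma computable_const c : computable (fun=> c).
Proof.
elim: c => [|c IH]; first by exists Zero => x; constructor.
exact: computable_succ.
Qed.

Lemma computable_pl f : computable f -> computable (fun x => pl (f x)).
Proof.
by apply: (@computable_comp pl); exists Left => x; rewrite -{1}[x]plprK; constructor.
Qed.

Lemma computable_pr f : computable f -> computable (fun x => pr (f x)).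
Proof.
by apply: (@computable_comp pr); exists Right => x; rewrite -{1}[x]plprK; constructor.
Qed.

Lemma computable_cpair f g : computable f -> computable g ->
  computable (fun x => cpair (f x) (g x)).
Proof. by move=> [e eP] [e' eP']; exists (Pair e e') => x; constructor. Qed.

Lemma computable_prim_rec a (g : nat -> nat -> nat -> nat) n : computable a ->
  computable (fun z => g (pl z) (pl (pr z)) (pr (pr z))) -> computable n ->
  computable (fun x => prim_rec (a x) (g x) (n x)).
Proof.
move=> [ea aP] [eg gP] [en nP]; have [ei iP] := computable_id.
exists (Comp (Prec ea eg) (Pair ei en)) => x.
apply: eval_comp (eval_pair (iP x) (nP x)) _.
elim: (n x) => [|m IH] /=; first exact: eval_prec0.
apply: eval_precS IH _.
by have := gP (cpair x (cpair m (prim_rec (a x) (g x) m))); rewrite plK !prK plK.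
Qed.

Lemma computable_add f g : computable f -> computable g -> computable (fun x => f x + g x).
Proof.
move=> cf cg; apply: (@eq_computable _ (fun x => prim_rec (f x) (fun _ r => r.+1) (g x))).
  by move=> x; elim: (g x) => [|m /= <-]; rewrite ?addn0 ?addnS.
apply: (@computable_prim_rec f (fun _ _ r => r.+1)) => //.
by apply/computable_succ/computable_pr/computable_pr/computable_id.
Qed.

Lemma computable_pred f : computable f -> computable (fun x => (f x).-1).
Proof.
move=> cf; apply: (@eq_computable _ (fun x => prim_rec 0 (fun m _ => m) (f x))).
  by move=> x; case: (f x).
apply: (@computable_prim_rec _ (fun _ m _ => m)) => //; first exact: computable_const.
exact/computable_pl/computable_pr/computable_id.
Qed.

Lemma computable_sub f g : computable f -> computable g -> computable (fun x => f x - g x).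
Proof.
move=> cf cg; apply: (@eq_computable _ (fun x => prim_rec (f x) (fun _ r => r.-1) (g x))).
  by move=> x; elim: (g x) => [|m /= <-]; rewrite ?subn0 ?subnS.
apply: (@computable_prim_rec f (fun _ _ r => r.-1)) => //.
exact/computable_pred/computable_pr/computable_pr/computable_id.
Qed.

Lemma computable_mul f g : computable f -> computable g -> computable (fun x => f x * g x).
Proof.
move=> cf cg; apply: (@eq_computable _ (fun x => prim_rec 0 (fun _ r => g x + r) (f x))).
  by move=> x; elim: (f x) => [|m /= <-]; rewrite ?mulSn.
apply: (@computable_prim_rec _ (fun x _ r => g x + r)) => //; first exact: computable_const.
apply: computable_add; last exact/computable_pr/computable_pr/computable_id.
by apply: computable_comp => //; apply/computable_pl/computable_id.
Qed.

Lemma computable_exp f g : computable f -> computable g -> computable (fun x => f x ^ g x).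
Proof.
move=> cf cg; apply: (@eq_computable _ (fun x => prim_rec 1 (fun _ r => f x * r) (g x))).
  by move=> x; elim: (g x) => [|m /= <-]; rewrite ?expnS.
apply: (@computable_prim_rec _ (fun x _ r => f x * r)) => //; first exact: computable_const.
apply: computable_mul; last exact/computable_pr/computable_pr/computable_id.
by apply: computable_comp => //; apply/computable_pl/computable_id.
Qed.

Lemma computable_leq f g : computable f -> computable g -> computable (fun x => f x <= g x).
Proof.
move=> cf cg; apply: (@eq_computable _ (fun x => 1 - (f x - g x))); last first.
  by apply: computable_sub; [exact: computable_const | exact: computable_sub].
by move=> x; rewrite /leq; case: (f x - g x).
Qed.

Lemma computable_negb p : computable p -> computable (fun x => ~~ p x).
Proof.
move=> cp; apply: (@eq_computable _ (fun x => 1 - p x)); first by move=> x; case: (p x).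
by apply: computable_sub => //; apply: computable_const.
Qed.

Lemma computable_andb p q : computable p -> computable q -> computable (fun x => p x && q x).
Proof.
move=> cp cq; apply: (@eq_computable _ (fun x => p x * q x)); last exact: computable_mul.
by move=> x; rewrite mulnb.
Qed.

Lemma computable_implyb p q : computable p -> computable q -> computable (fun x => p x ==> q x).
Proof.
move=> cp cq; apply: (@eq_computable _ (fun x => ~~ (p x && ~~ q x))).
  by move=> x; case: (p x); case: (q x).
by apply/computable_negb/computable_andb => //; apply: computable_negb.
Qed.

Lemma computable_eqn f g : computable f -> computable g -> computable (fun x => f x == g x).
Proof.
move=> cf cg; apply: (@eq_computable _ (fun x => (f x <= g x) && (g x <= f x))).
  by move=> x; rewrite eqn_leq.
by apply: computable_andb; apply: computable_leq.
Qed.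

Lemma computable_if p f g : computable p -> computable f -> computable g ->
  computable (fun x => if p x then f x else g x).
Proof.
move=> cp cf cg; apply: (@eq_computable _ (fun x => p x * f x + (~~ p x) * g x)).
  by move=> x; case: (p x); rewrite !mul1n mul0n ?addn0.
by apply: computable_add; apply: computable_mul => //; apply: computable_negb.
Qed.

Lemma computable_sum (F : nat -> nat -> nat) f :
  computable (fun z => F (pl z) (pr z)) -> computable f ->
  computable (fun x => bsum (f x) (F x)).
Proof.
move=> cF cf; rewrite /bsum.
apply: (@eq_computable _ (fun x => prim_rec 0 (fun i r => F x i + r) (f x))).
  by move=> x; elim: (f x) => [|m IH]; rewrite ?big_ord0 // big_ord_recr /= IH addnC.
apply: (@computable_prim_rec _ (fun x i r => F x i + r)) => //; first exact: computable_const.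
apply: computable_add; last exact/computable_pr/computable_pr/computable_id.
apply: (@eq_computable _ (fun z => (fun y => F (pl y) (pr y)) (cpair (pl z) (pl (pr z))))).
  by move=> z; rewrite plK prK.
apply: (@computable_comp (fun y => F (pl y) (pr y))) => //.
by apply: computable_cpair; last apply: computable_pl; try apply: computable_pr;
  try apply: computable_pl; apply: computable_id.
Qed.

Lemma computable_forall (P : nat -> nat -> bool) f :
  computable (fun z => P (pl z) (pr z)) -> computable f ->
  computable (fun x => bforall (f x) (P x)).
Proof.
move=> cP cf; apply: (@eq_computable _ (fun x => bsum (f x) (fun i => ~~ P x i) == 0)).
  move=> x; rewrite /bsum sum_nat_eq0; congr (nat_of_bool _).
  by apply: eq_forallb => i; case: (P x i).
apply: computable_eqn; last exact: computable_const.
by apply: (@computable_sum (fun x i => ~~ P x i)) => //; apply: computable_negb.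
Qed.

(** The quotient counts the positive multiples of [g x] up to [f x]; the test [0 < g x] yields the
    value 0 of division by zero. *)
Lemma computable_divn f g : computable f -> computable g -> computable (fun x => f x %/ g x).
Proof.
move=> cf cg.
apply: (@eq_computable _ (fun x => \sum_(i < f x) ((0 < g x) && (i.+1 * g x <= f x)))).
  move=> x; case: (posnP (g x)) => [->|g0]; first by rewrite divn0 big1.
  under eq_bigr do rewrite /= -leq_divRL //.
  have le : f x %/ g x <= f x by apply: leq_div.
  by rewrite sum_ltn_ord (minn_idPr le).
apply: (@computable_sum (fun x i => (0 < g x) && (i.+1 * g x <= f x))) => //.
have cgl : computable (fun z => g (pl z)).
  by apply: computable_comp => //; apply/computable_pl/computable_id.
apply: computable_andb; apply: computable_leq => //; first exact: computable_const.
  by apply: computable_mul => //; apply/computable_succ/computable_pr/computable_id.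
by apply: computable_comp => //; apply/computable_pl/computable_id.
Qed.

Lemma computable_modn f g : computable f -> computable g -> computable (fun x => f x %% g x).
Proof.
move=> cf cg; apply: (@eq_computable _ (fun x => f x - f x %/ g x * g x)).
  by move=> x; rewrite {2}(divn_eq (f x) (g x)) addKn.
by apply/computable_sub/computable_mul => //; apply: computable_divn.
Qed.

Lemma computable_odd f : computable f -> computable (fun x => odd (f x)).
Proof.
move=> cf; apply: (@eq_computable _ (fun x => f x %% 2)); first by move=> x; rewrite modn2.
by apply: computable_modn => //; apply: computable_const.
Qed.

Lemma computable_half f : computable f -> computable (fun x => (f x)./2).
Proof.
move=> cf; apply: (@eq_computable _ (fun x => f x %/ 2)); first by move=> x; rewrite divn2.
by apply: computable_divn => //; apply: computable_const.
Qed.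

Lemma computable_iter h f g : computable h -> computable f -> computable g ->
  computable (fun x => iter (f x) h (g x)).
Proof.
move=> ch cf cg; apply: (@eq_computable _ (fun x => prim_rec (g x) (fun _ r => h r) (f x))).
  by move=> x; elim: (f x) => [|m /= ->].
apply: (@computable_prim_rec _ (fun _ _ r => h r)) => //.
by apply: computable_comp => //; apply/computable_pr/computable_pr/computable_id.
Qed.

End Closure.

(* Matching on the head symbol keeps [apply] from unfolding definitions. *)
Ltac computable_head := lazymatch goal with
  | |- computable (fun x => pl (@?f x)) => apply (@computable_pl f)
  | |- computable (fun x => pr (@?f x)) => apply (@computable_pr f)
  | |- computable (fun x => cpair (@?f x) (@?g x)) => apply (@computable_cpair f g)
  | |- computable (fun x => (@?f x).+1) => apply (@computable_succ f)
  | |- computable (fun x => (@?f x).-1) => apply (@computable_pred f)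
  | |- computable (fun x => (@?f x)./2) => apply (@computable_half f)
  | |- computable (fun x => @?f x + @?g x) => apply (@computable_add f g)
  | |- computable (fun x => @?f x - @?g x) => apply (@computable_sub f g)
  | |- computable (fun x => @?f x * @?g x) => apply (@computable_mul f g)
  | |- computable (fun x => @?f x ^ @?g x) => apply (@computable_exp f g)
  | |- computable (fun x => @?f x %/ @?g x) => apply (@computable_divn f g)
  | |- computable (fun x => @?f x %% @?g x) => apply (@computable_modn f g)
  | |- computable (fun x => nat_of_bool (odd (@?f x))) => apply (@computable_odd f)
  | |- computable (fun x => nat_of_bool (@?f x <= @?g x)) => apply (@computable_leq f g)
  | |- computable (fun x => nat_of_bool (@?f x == @?g x)) => apply (@computable_eqn f g)
  | |- computable (fun x => nat_of_bool (~~ @?p x)) => apply (@computable_negb p)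
  | |- computable (fun x => nat_of_bool (@?p x && @?q x)) => apply (@computable_andb p q)
  | |- computable (fun x => nat_of_bool (@?p x ==> @?q x)) => apply (@computable_implyb p q)
  | |- computable (fun x => nat_of_bool (bforall (@?f x) (@?P x))) => apply (@computable_forall P f)
  | |- computable (fun x => bsum (@?f x) (@?F x)) => apply (@computable_sum F f)
  | |- computable (fun x => prim_rec (@?a x) (@?g x) (@?n x)) => apply (@computable_prim_rec a g n)
  | |- computable (fun x => iter (@?f x) ?h (@?g x)) => apply (@computable_iter h f g)
  | |- computable (fun x => ?f (@?g x)) => is_var f; apply (@computable_comp f g)
  end.

(* Extended by redefinition as further functions are shown computable. *)
Ltac computable_extra := fail.

Ltac computable_tac := repeat (cbv beta; first
  [ assumption | exact computable_id | apply computable_const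
  | computable_extra | computable_head | apply computable_if ]).

(** * The search program *)

(** The predecessor undoes the successor that separates nonempty codes from 0. As [pr 0] is 0,
    iteration past the end stays at the empty code. *)
Definition ctail (s : nat) : nat := pr s.-1.
Definition cnth (s i : nat) : nat := pl (iter i ctail s).-1.
Definition clen (s : nat) : nat := bsum s (fun i => iter i ctail s != 0).

(** A square pattern of side [N] is a number below [n ^ (N * N)], read in base [n]; all patterns are
    thus reached by a bounded quantifier. *)
Definition digit (n w i : nat) : nat := (w %/ n ^ i) %% n.
Definition cell (n N w a b : nat) : nat := digit n w ((a %% N) * N + b %% N).

(* [z] codes an integer; modulo [N], subtracting [q] is adding [q * (N - 1)]. *)
Definition shift_mod (N a z : nat) : nat :=
  a + (if odd z then 0 else z./2) + (if odd z then (z./2).+1 else 0) * N.-1.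

Definition torus_neighbours (dc n N w a b i : nat) : nat :=
  bsum (clen dc) (fun t => cell n N w (shift_mod N a (pl (cnth dc t)))
                              (shift_mod N b (pr (cnth dc t))) == i).

Definition torus_legal (dc bc N w a b : nat) : bool :=
  bforall (clen bc) (fun i =>
    torus_neighbours dc (clen bc) N w a b i == cnth (cnth bc i) (cell (clen bc) N w a b)).

(** A margin [s] that bounds the shape leaves only cells whose neighbourhoods do not wrap around;
    with [s = 0] the whole torus is tested. *)
Definition torus_valid (dc bc N s w : nat) : bool :=
  bforall N (fun a => bforall N (fun b =>
    [&& s <= a, a + s < N, s <= b & b + s < N] ==> torus_legal dc bc N w a b)).

Definition periodic_at (n N w h k : nat) : bool :=
  (cell n N w (h + k) h == cell n N w h h) && (cell n N w h (h + k) == cell n N w h h).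

(** The side for which [(h, h)], [(h + k, h)] and [(h, h + k)] are all at distance at least [h] from
    the border. *)
Definition window (h k : nat) : nat := (h + h + k).+1.

(** The code [dc] itself serves as margin, since it bounds the coordinates of the shape
    ([shape_coord_le]). *)
Definition certificate (dc bc k h : nat) : bool :=
  bforall (clen bc ^ (window h k * window h k)) (fun w =>
    torus_valid dc bc (window h k) dc w ==> periodic_at (clen bc) (window h k) w h k).

(** The code is built from its last entry, hence the index [T - j.+1]. *)
Definition digits_code (n w T : nat) : nat :=
  prim_rec 0 (fun j r => (cpair (digit n w (T - j.+1)) r).+1) T.

Definition listing (dc bc k : nat) : nat :=
  prim_rec 0 (fun w r =>
    if torus_valid dc bc k 0 w then (cpair (cpair k (digits_code (clen bc) w (k * k))) r).+1 else r)
    (clen bc ^ (k * k)).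

Lemma computable_ctail s : computable s -> computable (fun x => ctail (s x)).
Proof. by move=> *; rewrite /ctail; computable_tac. Qed.

Ltac computable_extra ::= lazymatch goal with
  | |- computable (fun x => ctail (@?s x)) => apply (@computable_ctail s)
  end.

Lemma computable_cnth s i : computable s -> computable i -> computable (fun x => cnth (s x) (i x)).
Proof. by move=> *; have := computable_ctail computable_id; rewrite /cnth => *; computable_tac. Qed.

Lemma computable_clen s : computable s -> computable (fun x => clen (s x)).
Proof. by move=> *; have := computable_ctail computable_id; rewrite /clen => *; computable_tac. Qed.

Lemma computable_cell n N w a b : computable n -> computable N -> computable w ->
  computable a -> computable b -> computable (fun x => cell (n x) (N x) (w x) (a x) (b x)).
Proof. by move=> *; rewrite /cell /digit; computable_tac. Qed.

Lemma computable_shift_mod N a t : computable N -> computable a -> computable t ->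
  computable (fun x => shift_mod (N x) (a x) (t x)).
Proof. by move=> *; rewrite /shift_mod; computable_tac. Qed.

Ltac computable_extra ::= lazymatch goal with
  | |- computable (fun x => ctail (@?s x)) => apply (@computable_ctail s)
  | |- computable (fun x => cnth (@?s x) (@?i x)) => apply (@computable_cnth s i)
  | |- computable (fun x => clen (@?s x)) => apply (@computable_clen s)
  | |- computable (fun x => cell (@?n x) (@?N x) (@?w x) (@?a x) (@?b x)) =>
      apply (@computable_cell n N w a b)
  | |- computable (fun x => shift_mod (@?N x) (@?a x) (@?t x)) =>
      apply (@computable_shift_mod N a t)
  end.

Lemma computable_torus_valid dc bc N s w : computable dc -> computable bc -> computable N ->
  computable s -> computable w ->
  computable (fun x => torus_valid (dc x) (bc x) (N x) (s x) (w x)).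
Proof.
by move=> *; rewrite /torus_valid /torus_legal /torus_neighbours; computable_tac.
Qed.

Lemma computable_digits_code n w k : computable n -> computable w -> computable k ->
  computable (fun x => digits_code (n x) (w x) (k x)).
Proof. by move=> *; rewrite /digits_code /digit; computable_tac. Qed.

Ltac computable_extra ::= lazymatch goal with
  | |- computable (fun x => clen (@?s x)) => apply (@computable_clen s)
  | |- computable (fun x => cell (@?n x) (@?N x) (@?w x) (@?a x) (@?b x)) =>
      apply (@computable_cell n N w a b)
  | |- computable (fun x => nat_of_bool (torus_valid (@?dc x) (@?bc x) (@?N x) (@?s x) (@?w x))) =>
      apply (@computable_torus_valid dc bc N s w)
  | |- computable (fun x => digits_code (@?n x) (@?w x) (@?k x)) =>
      apply (@computable_digits_code n w k)
  end.

Lemma computable_certificate dc bc k h : computable dc -> computable bc -> computable k ->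
  computable h -> computable (fun x => certificate (dc x) (bc x) (k x) (h x)).
Proof. by move=> *; rewrite /certificate /periodic_at /window; computable_tac. Qed.

Lemma computable_listing dc bc k : computable dc -> computable bc -> computable k ->
  computable (fun x => listing (dc x) (bc x) (k x)).
Proof. by move=> *; rewrite /listing; computable_tac. Qed.

(* The search is over pairs [(k - 1, h)], so that the period [k] is positive. *)
Lemma search_program : exists e : prf, forall dc bc tc,
  (exists k h, certificate dc bc k.+1 h) -> exists k h, certificate dc bc k.+1 h /\
    eval e (cpair dc (cpair bc tc)) (listing dc bc k.+1).
Proof.
(* The test is negated because [Rfind] stops at the value 0. *)
have [ec cP] : computable (fun z =>
    ~~ certificate (pl (pl z)) (pl (pr (pl z))) (pl (pr z)).+1 (pr (pr z))).
  apply: computable_negb; apply: computable_certificate; computable_tac.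
have [el lP] : computable (fun z => listing (pl (pl z)) (pl (pr (pl z))) (pl (pr z)).+1).
  apply: computable_listing; computable_tac.
have [ei iP] := computable_id.
exists (Comp el (Pair ei (Rfind ec))) => dc bc tc [k0 [h0 cert0]].
pose found m := certificate dc bc (pl m).+1 (pr m).
have ex : exists m, found m by exists (cpair k0 h0); rewrite /found plK prK.
case: (ex_minnP ex) => m fm mmin; exists (pl m), (pr m); split=> //.
set x := cpair _ _; have xE : pl x = dc /\ pl (pr x) = bc by rewrite /x !plK prK plK.
clearbody x.
apply: (@eval_comp _ _ _ (cpair x m)).
  apply: eval_pair (iP x) (@eval_rfind _ _ _ (fun=> 0) _ _).
    move=> j ltj; have := cP (cpair x j); rewrite !plK !prK (proj1 xE) (proj2 xE).
    case E: (certificate _ _ _ _) => //.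
    by have := mmin j E; rewrite leqNgt ltj.
  have := cP (cpair x m); rewrite !plK !prK (proj1 xE) (proj2 xE).
  by move: fm; rewrite /found => ->.
by have := lP (cpair x m); rewrite !plK !prK (proj1 xE) (proj2 xE).
Qed.

Local Open Scope ring_scope.

(** * Correctness of the program *)

Section Codes.
Variables (T : Type) (code : T -> nat).

Lemma iter_ctail_code i s : iter i ctail (code_seq code s) = code_seq code (drop i s).
Proof.
elim: i s => [|i IH] s; first by rewrite drop0.
have tl : ctail (code_seq code s) = code_seq code (behead s).
  by case: s => //= x s; rewrite /ctail prK.
by rewrite iterSr tl IH -drop1 drop_drop addn1.
Qed.

Lemma cnth_code x0 s i : (i < size s)%N -> cnth (code_seq code s) i = code (nth x0 s i).
Proof. by move=> lt; rewrite /cnth iter_ctail_code (drop_nth x0 lt) /= plK. Qed.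

Lemma cpair_ger a b : (b <= cpair a b)%N.
Proof. exact: leq_addl. Qed.

Lemma cpair_gel a b : (a <= cpair a b)%N.
Proof.
apply: leq_trans (leq_addr b _); rewrite binS bin1.
by apply: leq_trans (leq_addr b a) (leq_addl _ _).
Qed.

Lemma clen_code s : clen (code_seq code s) = size s.
Proof.
have le : (size s <= code_seq code s)%N.
  by elim: s => //= x s IH; rewrite ltnS (leq_trans IH) ?cpair_ger.
rewrite -[RHS](minn_idPr le) -sum_ltn_ord; apply: eq_bigr => i _.
rewrite iter_ctail_code; case: ltnP => [lt|ge]; last by rewrite drop_oversize.
case E: (drop i s) => [|x r]; last by [].
by have := size_drop i s; rewrite E => /esym/eqP; rewrite subn_eq0 leqNgt lt.
Qed.

Lemma code_seq_ge x0 s i : (i < size s)%N -> (code (nth x0 s i) <= code_seq code s)%N.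
Proof.
elim: s i => [//|x s IH] [|i] /= lt; rewrite leqW //; first exact: cpair_gel.
by apply: leq_trans (IH i lt) (cpair_ger _ _).
Qed.

End Codes.

Lemma code_int_ge (z : int) : (absz z <= code_int z)%N.
Proof. by case: z => m /=; lia. Qed.

Lemma shift_modP (N a : nat) (z : int) : (0 < N)%N ->
  (shift_mod N a (code_int z) %% N)%N%:Z = ((a%:Z + z) %% N%:Z)%Z.
Proof.
case: N => // N _; rewrite -modz_nat /shift_mod; case: z => m.
  by rewrite /= odd_double doubleK mul0n addn0.
rewrite /= odd_double /= addn0 uphalf_double.
rewrite (_ : Posz (a + m.+1 * N) = m.+1%:Z * N.+1%:Z + (a%:Z + Negz m)) ?modzMDl //.
by rewrite NegzE; nia.
Qed.

Lemma digits_exist (n T : nat) (f : nat -> nat) : (forall i, (i < T)%N -> (f i < n)%N) ->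
  exists2 w, (w < n ^ T)%N & forall i, (i < T)%N -> digit n w i = f i.
Proof.
elim: T f => [|T IH] f lt; first by exists 0%N.
have [w ltw wP] := IH (fun i => f i.+1) (fun i => lt i.+1).
have f0 := lt 0%N isT; have n0 : (0 < n)%N by apply: leq_trans f0.
exists (w * n + f 0%N)%N.
  rewrite expnSr (@leq_trans (w.+1 * n)) //; last by rewrite leq_mul2r ltw orbT.
  by rewrite mulSn addnC ltn_add2r.
case=> [|i] lti; first by rewrite /digit expn0 divn1 modnMDl modn_small.
by rewrite /digit expnS divnMA divnMDl // (divn_small f0) addn0 -wP.
Qed.

(** * Soundness and completeness of certificates on finite windows *)

Section Torus.
Variable n : nat.
Implicit Types (c : config n.+1).

Definition torus (N w : nat) : config n.+1 :=
  fun u => inord (cell n.+1 N w (absz (u.1 %% N%:Z)%Z) (absz (u.2 %% N%:Z)%Z)).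

Lemma cell_lt N w a b : (cell n.+1 N w a b < n.+1)%N.
Proof. exact: ltn_pmod. Qed.

Lemma cell_mod N w a b : cell n.+1 N w (a %% N) (b %% N) = cell n.+1 N w a b.
Proof. by rewrite /cell !modn_mod. Qed.

Lemma torusE N w (a b : nat) (x y : int) : (0 < N)%N ->
  (a %% N)%N%:Z = (x %% N%:Z)%Z -> (b %% N)%N%:Z = (y %% N%:Z)%Z ->
  torus N w (x, y) = cell n.+1 N w a b :> nat.
Proof. by move=> N0 ea eb; rewrite /torus /= -ea -eb inordK ?cell_lt // cell_mod. Qed.

Lemma torus_nat N w (a b : nat) : (0 < N)%N -> torus N w (a%:Z, b%:Z) = cell n.+1 N w a b :> nat.
Proof. by move=> N0; apply: torusE; rewrite // modz_nat. Qed.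

Lemma torus_ext N c : (0 < N)%N -> exists2 w, (w < n.+1 ^ (N * N))%N &
  forall a b : nat, (a < N)%N -> (b < N)%N -> torus N w (a%:Z, b%:Z) = c (a%:Z, b%:Z).
Proof.
move=> N0; have [w ltw wP] := @digits_exist n.+1 (N * N) (fun i => c ((i %/ N)%N%:Z, (i %% N)%N%:Z))
  (fun i _ => ltn_ord _).
exists w => // a b lta ltb; apply: val_inj; rewrite /= torus_nat // /cell !modn_small // wP.
  by rewrite divnMDl // divn_small // addn0 modnMDl modn_small.
by apply: (@leq_trans (a.+1 * N)); [rewrite mulSn addnC ltn_add2r | rewrite leq_mul2r lta orbT].
Qed.

Variables (D : {fset vec}) (B : 'M[nat]_n.+1) (sD : seq vec).
Hypothesis sDD : perm_eq sD D.
Local Notation dc := (code_seq code_vec sD).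
Local Notation bc := (code_mx B).

Lemma clen_mx : clen bc = n.+1.
Proof. by rewrite clen_code size_map size_enum_ord. Qed.

Lemma cnth_mx (i j : 'I_n.+1) : cnth (cnth bc i) j = B i j.
Proof.
have se (T : Type) (f : 'I_n.+1 -> T) : size [seq f x | x <- enum 'I_n.+1] = n.+1.
  by rewrite size_map size_enum_ord.
have ne (T : Type) (x0 : T) (f : 'I_n.+1 -> T) (x : 'I_n.+1) :
    nth x0 [seq f y | y <- enum 'I_n.+1] x = f x.
  by rewrite (nth_map x) ?size_enum_ord // nth_ord_enum.
rewrite (@cnth_code _ _ [::]) ?se // (ne _ [::] (fun i => [seq B i j | j <- enum 'I_n.+1])).
by rewrite (@cnth_code _ _ 0%N) ?se // ne.
Qed.

Lemma torus_neighboursE N w (a b : nat) (i : 'I_n.+1) : (0 < N)%N ->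
  torus_neighbours dc n.+1 N w a b i = neighbours D (torus N w) (a%:Z, b%:Z) i.
Proof.
move=> N0; rewrite /neighbours -(perm_big _ sDD) (big_nth (0 : vec)) big_mkord.
rewrite /torus_neighbours /bsum clen_code; apply: eq_bigr => t _.
rewrite (@cnth_code _ _ (0 : vec)) // plK prK -val_eqE /=.
by rewrite (@torusE _ _ (shift_mod N a (code_int (nth (0 : vec) sD t).1))
  (shift_mod N b (code_int (nth (0 : vec) sD t).2))) ?shift_modP.
Qed.

Lemma torus_legalP N w (a b : nat) : (0 < N)%N ->
  reflect (legal_at D B (torus N w) (a%:Z, b%:Z)) (torus_legal dc bc N w a b).
Proof.
move=> N0; have tE : cell n.+1 N w a b = torus N w (a%:Z, b%:Z) by rewrite torus_nat.
rewrite /torus_legal /bforall clen_mx; apply: (iffP forallP) => h i; have := h i.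
  by rewrite torus_neighboursE // tE cnth_mx => /eqP.
by rewrite torus_neighboursE // tE cnth_mx => ->.
Qed.

Lemma torus_validP N s w : (0 < N)%N ->
  reflect (forall a b : nat, (s <= a)%N -> (a + s < N)%N -> (s <= b)%N -> (b + s < N)%N ->
     legal_at D B (torus N w) (a%:Z, b%:Z)) (torus_valid dc bc N s w).
Proof.
move=> N0; apply: (iffP forallP) => h.
  move=> a b sa aN sb bN; apply/torus_legalP => //.
  have lta : (a < N)%N by apply: leq_ltn_trans (leq_addr _ _) aN.
  have ltb : (b < N)%N by apply: leq_ltn_trans (leq_addr _ _) bN.
  have /forallP/(_ (Ordinal ltb))/implyP := h (Ordinal lta); apply.
  by rewrite sa aN sb bN.
move=> a; apply/forallP => b; apply/implyP => /and4P[sa aN sb bN].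
by apply/torus_legalP => //; apply: h.
Qed.

Lemma shape_coord_le d : d \in D -> (absz d.1 <= dc)%N /\ (absz d.2 <= dc)%N.
Proof.
rewrite -(perm_mem sDD) => /(nthP (0 : vec))[t lt <-].
have := code_seq_ge code_vec (0 : vec) lt; rewrite /code_vec => le.
split; apply: leq_trans (leq_trans (code_int_ge _) _) le; [exact: cpair_gel | exact: cpair_ger].
Qed.

(** Translate the coloring so that [u] sits at [(h, h)]. Its window is a valid pattern, as the
    margin keeps the neighbourhoods of tested cells inside, and the certificate yields both periods
    at [u]. *)
Lemma certificate_sound k h : certificate dc bc k h ->
  forall c, coloring D B c -> forall u, c (u + (k%:Z, 0)) = c u /\ c (u + (0, k%:Z)) = c u.
Proof.
move=> cert c cX u; pose N := window h k.
pose c' : config n.+1 := fun v => c (v + (u - (h%:Z, h%:Z))).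
have N0 : (0 < N)%N by [].
have [w ltw wP] := torus_ext c' N0.
move: cert; rewrite /certificate /bforall clen_mx => /forallP/(_ (Ordinal ltw))/implyP /=.
have /coloringP c'X : coloring D B c' by apply: coloring_shift.
case/(_ _)/andP => [|/eqP e1 /eqP e2].
  apply/torus_validP => // a b sa aN sb bN.
  have lta : (a < N)%N by apply: leq_ltn_trans (leq_addr _ _) aN.
  have ltb : (b < N)%N by apply: leq_ltn_trans (leq_addr _ _) bN.
  apply: legal_at_local (c'X (a%:Z, b%:Z)); first by rewrite wP.
  move=> [x y] /shape_coord_le /= [lex ley].
  have [a' a'E] : exists a' : nat, a%:Z + x = a'%:Z by exists (absz (a%:Z + x)%R); lia.
  have [b' b'E] : exists b' : nat, b%:Z + y = b'%:Z by exists (absz (b%:Z + y)%R); lia.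
  rewrite (_ : (a%:Z, b%:Z) + (x, y) = (a'%:Z, b'%:Z)); last by rewrite -a'E -b'E.
  by rewrite wP //; lia.
have hN : (h < N)%N by rewrite /N /window; lia.
have hkN : (h + k < N)%N by rewrite /N /window; lia.
have eqc (a b : nat) : (a < N)%N -> (b < N)%N -> c' (a%:Z, b%:Z) = cell n.+1 N w a b :> nat.
  by move=> lta ltb; rewrite -wP // torus_nat.
split; apply: val_inj.
  have := eqc _ _ hkN hN; rewrite e1 -(eqc h h) // /c' => e.
  rewrite (_ : u + _ = ((h + k)%N%:Z, h%:Z) + (u - (h%:Z, h%:Z))); last first.
    by case: (u) => x y; congr pair => /=; ring.
  by rewrite /= e addrC subrK.
have := eqc _ _ hN hkN; rewrite e2 -(eqc h h) // /c' => e.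
rewrite (_ : u + _ = (h%:Z, (h + k)%N%:Z) + (u - (h%:Z, h%:Z))); last first.
  by case: (u) => x y; congr pair => /=; ring.
by rewrite /= e addrC subrK.
Qed.

(** Compactness: otherwise every [h] has a valid pattern that breaks periodicity at its centre.
    Recentred there, these patterns have a limit, which is a coloring and so periodic at 0; the
    limit agrees with some pattern on the three cells concerned. *)
Lemma certificate_complete k :
  (forall c, coloring D B c -> c (k%:Z, 0) = c 0 /\ c (0, k%:Z) = c 0) ->
  exists h, certificate dc bc k h.
Proof.
move=> per; apply: contrapT => no.
have bad h : exists w, torus_valid dc bc (window h k) dc w /\ ~ periodic_at n.+1 (window h k) w h k.
  apply: contrapT => nw; apply: no; exists h; rewrite /certificate /bforall clen_mx.
  apply/forallP => w; apply/implyP => val; apply/negP => /negP np; apply: nw.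
  by exists w; split=> //; apply/negP.
have [w wP] := exists_choice bad; have [U FU] := free_ultrafilter_exists.
pose c h : config n.+1 := fun u => torus (window h k) (w h) (u + (h%:Z, h%:Z)).
have [c' c'P] := ultra_limit FU c.
have c'X : coloring D B c'.
  apply: (ultra_limit_legal FU c'P) => -[x y].
  (* From this [h] on, the recentred point keeps the margin [dc] from the border. *)
  apply: (ultraS FU _ (ultra_large FU (absz x + absz y + dc)%N)) => h le.
  have [/torus_validP valid _] := wP h.
  have [a aE] : exists a : nat, x + h%:Z = a%:Z by exists (absz (x + h%:Z)%R); lia.
  have [b bE] : exists b : nat, y + h%:Z = b%:Z by exists (absz (y + h%:Z)%R); lia.
  apply: (@legal_at_local _ _ _ (torus (window h k) (w h)) _ (a%:Z, b%:Z)).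
  - by rewrite -aE -bE.
  - by move=> d _; rewrite /c addrAC -aE -bE.
  - by apply: valid; rewrite // /window; lia.
have [p1 p2] := per c' c'X.
have [h [[h0 h1] h2]] :=
  ultra_ex FU (ultraI FU (ultraI FU (c'P 0) (c'P (k%:Z, 0))) (c'P (0, k%:Z))).
have [_] := wP h; apply; have N0 : (0 < window h k)%N by [].
have e1 : c h (k%:Z, 0) = c h 0 by rewrite h0 h1.
have e2 : c h (0, k%:Z) = c h 0 by rewrite h0 h2.
have oE : (h%:Z, h%:Z) = 0 + (h%:Z, h%:Z) :> vec by rewrite add0r.
have xE : ((h + k)%N%:Z, h%:Z) = (k%:Z, 0) + (h%:Z, h%:Z) :> vec by rewrite PoszD addrC.
have yE : (h%:Z, (h + k)%N%:Z) = (0, k%:Z) + (h%:Z, h%:Z) :> vec by rewrite PoszD addrC.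
rewrite /periodic_at -!(torus_nat _ _ _ N0) xE yE oE.
by apply/andP; split; apply/eqP; congr nat_of_ord; [exact: e1 | exact: e2].
Qed.

End Torus.

Lemma prim_rec_filter (P : pred nat) (f : nat -> nat) m :
  prim_rec 0 (fun w r => if P w then (cpair (f w) r).+1 else r) m =
  code_seq f [seq w <- rev (iota 0 m) | P w].
Proof.
elim: m => [//|m IH]; rewrite [LHS]/= IH -[in RHS]addn1 iotaD rev_cat /= add0n.
by case: (P m).
Qed.

Lemma digits_codeE n w T : digits_code n w T = code_seq id [seq digit n w i | i <- iota 0 T].
Proof.
rewrite /digits_code.
suff H j : (j <= T)%N -> prim_rec 0 (fun j r => (cpair (digit n w (T - j.+1)) r).+1) j =
    code_seq id [seq digit n w i | i <- iota (T - j) j] by rewrite H // subnn.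
by elim: j => [//|j IH] lt; rewrite /= IH 1?ltnW // subnSK.
Qed.

Definition torus_descr (n k w : nat) : descr := (k, [seq digit n w i | i <- iota 0 (k * k)]).

Lemma listingE dc bc k : listing dc bc k = code_seq code_descr
  [seq torus_descr (clen bc) k w | w <- rev (iota 0 (clen bc ^ (k * k))) & torus_valid dc bc k 0 w].
Proof.
rewrite /listing prim_rec_filter; elim: [seq _ <- _ | _] => //= w s ->.
by rewrite digits_codeE.
Qed.

(** * Enumeration of the periodic colorings *)

Section Listing.
Variables (n : nat) (D : {fset vec}) (B : 'M[nat]_n.+1) (sD : seq vec).
Hypothesis sDD : perm_eq sD D.
Local Notation dc := (code_seq code_vec sD).
Local Notation bc := (code_mx B).

Lemma periodic_int (c : config n.+1) (v : vec) :
  (forall u, c (u + v) = c u) -> forall (m : int) u, c (u + v *~ m) = c u.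
Proof.
move=> per; have pern (m : nat) u : c (u + v *+ m) = c u.
  by elim: m => [|m IH]; rewrite ?mulr0n ?addr0 // mulrSr addrA per.
case=> m u; first exact: pern.
by rewrite NegzE mulrNz -(pern m.+1 (u - _)) subrK.
Qed.

Lemma periodic_modz (k : nat) (c : config n.+1) :
  (forall u, c (u + (k%:Z, 0)) = c u /\ c (u + (0, k%:Z)) = c u) ->
  forall x y : int, c (x, y) = c ((x %% k%:Z)%Z, (y %% k%:Z)%Z).
Proof.
move=> per x y.
rewrite -[RHS](periodic_int (fun u => proj1 (per u)) (x %/ k%:Z)%Z).
rewrite -[RHS](periodic_int (fun u => proj2 (per u)) (y %/ k%:Z)%Z).
rewrite {1}(divz_eq x k%:Z) {1}(divz_eq y k%:Z).
congr c; rewrite [LHS]surjective_pairing [RHS]surjective_pairing.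
by rewrite !raddfD !raddfMz /= !mul0rz !mulrzz; congr pair; ring.
Qed.

Lemma absz_modz_lt (k : nat) (x : int) : (0 < k)%N -> (absz (x %% k%:Z)%Z < k)%N.
Proof.
move=> k0; rewrite -ltz_nat gez0_abs; first by apply: ltz_pmod; rewrite ltz_nat.
by rewrite modz_ge0 // eqz_nat -lt0n.
Qed.

Lemma torus_modz k w (x y : int) : (0 < k)%N ->
  torus n k w (x, y) = torus n k w ((x %% k%:Z)%Z, (y %% k%:Z)%Z).
Proof. by move=> k0; rewrite /torus /= !modz_mod. Qed.

Lemma torus_describes k w : (0 < k)%N -> describes (torus_descr n.+1 k w) (torus n k w).
Proof.
move=> k0; split=> // [|x y]; first by rewrite size_map size_iota.
have ltx := absz_modz_lt x k0; have lty := absz_modz_lt y k0.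
have lt : (absz (x %% k%:Z)%Z * k + absz (y %% k%:Z)%Z < k * k)%N.
  apply: (@leq_trans ((absz (x %% k%:Z)%Z).+1 * k)); first by rewrite mulSn addnC ltn_add2r.
  by rewrite leq_mul2r ltx orbT.
rewrite (nth_map 0%N) ?size_iota // nth_iota // add0n.
by rewrite /torus /= inordK ?cell_lt // /cell !modn_small.
Qed.

Lemma torus_coloring k w : (0 < k)%N -> torus_valid dc bc k 0 w -> coloring D B (torus n k w).
Proof.
move=> k0 /(torus_validP _ sDD _ _ k0) valid; apply/coloringP => -[x y].
have ltx := absz_modz_lt x k0; have lty := absz_modz_lt y k0.
have aE : (absz (x %% k%:Z)%Z)%:Z = (x %% k%:Z)%Z by rewrite gez0_abs // modz_ge0 // eqz_nat -lt0n.
have bE : (absz (y %% k%:Z)%Z)%:Z = (y %% k%:Z)%Z by rewrite gez0_abs // modz_ge0 // eqz_nat -lt0n.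
apply: legal_at_local (valid (absz (x %% k%:Z)%Z) (absz (y %% k%:Z)%Z) _ _ _ _); rewrite ?addn0 //.
  by rewrite aE bE -torus_modz.
by move=> [d e] _; rewrite aE bE torus_modz // [RHS]torus_modz //= !modzDml.
Qed.

Lemma listing_correct k : (0 < k)%N ->
  (forall c, coloring D B c -> forall u, c (u + (k%:Z, 0)) = c u /\ c (u + (0, k%:Z)) = c u) ->
  exists2 l, lists_colorings D B l & listing dc bc k = code_seq code_descr l.
Proof.
move=> k0 per; eexists; last exact: listingE.
rewrite clen_mx; split=> [d /mapP[w]|c cX].
  rewrite mem_filter => /andP[valid _] ->; exists (torus n k w); last exact: torus_describes.
  exact: torus_coloring.
have [w ltw wP] := torus_ext c k0.
have cE : c = torus n k w.
  apply: funext => -[x y]; rewrite torus_modz // (periodic_modz (per c cX)).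
  have ltx := absz_modz_lt x k0; have lty := absz_modz_lt y k0.
  have := wP _ _ ltx lty; rewrite !gez0_abs ?modz_ge0 // ?eqz_nat -?lt0n //.
exists (torus_descr n.+1 k w); last by rewrite cE; apply: torus_describes.
apply: map_f; rewrite mem_filter mem_rev mem_iota add0n ltw !andbT.
apply/(torus_validP _ sDD _ _ k0) => a b _ _ _ _; rewrite -cE.
by move/coloringP: cX; apply.
Qed.

End Listing.

Lemma listing_program (R : realType) : exists e : prf,
  forall (n : nat) (D : {fset vec}) (B : 'M[nat]_n) (t0 : int), admissible R D B t0 ->
  forall x : nat, represents D B t0 x ->
  exists2 l : seq descr, lists_colorings D B l & eval e x (code_seq code_descr l).
Proof.
have [e eP] := search_program; exists e => n D B t0 adm x [sD sDD ->].
case: n B adm => [|n] B adm.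
  (* Over the empty alphabet there are no patterns: certificates hold vacuously and the listing is
     empty. *)
  have no_cell : clen (code_mx B) = 0%N by rewrite clen_code size_map size_enum_ord.
  have [|k [h [_ ev]]] := eP (code_seq code_vec sD) (code_mx B) (code_int t0).
    exists 0%N, 0%N; rewrite /certificate no_cell exp0n //.
    by apply/forallP => -[].
  exists [::]; first by split=> // c; case: (c 0).
  by move: ev; rewrite listingE no_cell exp0n.
have [r det] := admissible_determined adm.
have [[//|k] _ per] := determined_period det.
(* The common period makes the search terminate. It may stop at another pair, whose [k'.+1] is a
   period of all colorings by [certificate_sound]. *)
have [|k' [h [cert ev]]] := eP (code_seq code_vec sD) (code_mx B) (code_int t0).
  exists k; apply: (certificate_complete sDD) => c cX.
  have px := per c cX 0 (1, 0); have py := per c cX 0 (0, 1).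
  move: px py; rewrite !add0r.
  have -> : ((1, 0) : vec) *+ k.+1 = (k.+1%:Z, 0).
    by rewrite [LHS]surjective_pairing !raddfMn /= mul0rn natz.
  have -> : ((0, 1) : vec) *+ k.+1 = (0, k.+1%:Z).
    by rewrite [LHS]surjective_pairing !raddfMn /= mul0rn natz.
  by move=> -> ->.
have [//|l lP lE] := @listing_correct n D B sD sDD k'.+1 _ (certificate_sound sDD cert).
by exists l; rewrite // -lE.
Qed.

Lemma decide_program (R : realType) : exists e : prf,
  forall (n : nat) (D : {fset vec}) (B : 'M[nat]_n) (t0 : int), admissible R D B t0 ->
  forall x : nat, represents D B t0 x ->
  ((exists c : config n, coloring D B c) -> eval e x 1%N) /\
  (~ (exists c : config n, coloring D B c) -> eval e x 0%N).
Proof.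
have [e eP] := listing_program R.
(* The code of a list is 0 exactly when the list is empty. *)
have [e' e'P] : computable (fun z => z != 0%N) by computable_tac.
exists (Comp e' e) => n D B t0 adm x xP; have [l [lc cl] ev] := eP n D B t0 adm x xP.
split=> [[c /cl[d dl _]]|no].
  apply: (eval_comp ev); have := e'P (code_seq code_descr l).
  by case: l dl {lc cl ev}.
apply: (eval_comp ev); have := e'P (code_seq code_descr l).
case: l lc {cl ev} => //= d l lc; have [c cX _] := lc d (mem_head _ _).
by case: no; exists c.
Qed.

Local Open Scope classical_set_scope.

Theorem theorem29 (R : realType) :
  [/\ (* there are finitely many (D, B)-colorings *)
      forall (n : nat) (D : {fset int * int}) (B : 'M[nat]_n) (t0 : int),
        admissible R D B t0 ->
        finite_set [set c : config n | coloring D B c],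
      (* they can be effectively constructed from D, B and t0 *)
      exists e : prf,
        forall (n : nat) (D : {fset int * int}) (B : 'M[nat]_n) (t0 : int),
        admissible R D B t0 ->
        forall x : nat, represents D B t0 x ->
        exists2 l : seq descr,
          lists_colorings D B l & eval e x (code_seq code_descr l) &
      (* and their existence can be decided *)
      exists e : prf,
        forall (n : nat) (D : {fset int * int}) (B : 'M[nat]_n) (t0 : int),
        admissible R D B t0 ->
        forall x : nat, represents D B t0 x ->
        ((exists c : config n, coloring D B c) -> eval e x 1%N) /\
        (~ (exists c : config n, coloring D B c) -> eval e x 0%N)].
Proof.
split.
- move=> n D B t0 /admissible_determined[r]; exact: determined_finite.
- exact: listing_program.
- exact: decide_program.
Qed.
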